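(* The $n$-dimensional near double path hypercube graph associahedron has $f$-vector equal to the $f$-vector of the $n$-dimensional cyclohedron.
   Context: Let $\pm[n]=\{-n,\dots,-1,1,\dots,n\}$. The near double path hypercube graph is the graph on $\pm[n]$ consisting of the path $(1,2,\dots,n-1,n,-1)$ and the path $(-2,-3,\dots,-n)$, consecutive vertices of each path being adjacent, with no other edges (for $n=1$ the pair $\{1,-1\}$ plays no role as an edge). A tube is a nonempty subset of $\pm[n]$ inducing a connected subgraph and containing no pair $\{i,-i\}$. Two tubes are weakly compatible if one is contained in the other, or they are disjoint with no edge between them. A tubing is a set of pairwise weakly compatible tubes whose union contains no pair $\{i,-i\}$. The hypercube graph associahedron is the simple $n$-dimensional polytope whose dual simplicial complex (sets of facets with nonempty intersection) is isomorphic to the complex of tubings, so its $k$-dimensional faces correspond to tubings with $n-k$ tubes. The $n$-dimensional cyclohedron is the simple polytope whose codimension-$k$ faces correspond, with reverse inclusion, to sets of $k$ pairwise compatible tubes of the cycle graph on $n+1$ vertices, where here a tube is a nonempty proper subset of vertices inducing a connected subgraph, and two tubes are compatible if one contains the other or they are disjoint and non-adjacent. The $f$-vector of a polytope lists the numbers of its $k$-dimensional faces, $0\le k\le n$. *)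

(* Defs.v *)
From HB Require Import structures.
From mathcomp Require Import all_boot all_order all_algebra finmap.
From mathcomp Require Import boolp classical_sets functions cardinality reals.

Set Implicit Arguments.
Unset Strict Implicit.
Unset Printing Implicit Defensive.
Import Order.TTheory GRing.Theory Num.Theory.

Section ConnectedSubsets.
Variables (T : finType) (e : rel T).

Definition induces_connected (A : {set T}) : bool :=
  [forall x in A, forall y in A,
    connect [rel u v | [&& u \in A, v \in A & e u v]] x y].

Definition compatible (A B : {set T}) : bool :=
  [|| A \subset B, B \subset A |
      [disjoint A & B] && [forall x in A, forall y in B, ~~ e x y]].

Definition pairwise_compatible (S : {set {set T}}) : bool :=
  [forall A in S, forall B in S, compatible A B].

End ConnectedSubsets.

(* (i, true) stands for the vertex i + 1 of {-n, .., -1, 1, .., n}, and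
   (i, false) for the vertex - (i + 1). *)
Definition pm (n : nat) : finType := ('I_n * bool)%type.

Definition pm_int n (u : pm n) : int :=
  if u.2 then Posz u.1.+1 else (- Posz u.1.+1)%R.

Definition pm_opp n (u : pm n) : pm n := (u.1, ~~ u.2).

Definition no_antipodal n (A : {set pm n}) : bool :=
  [forall u, ~~ ((u \in A) && (pm_opp u \in A))].

Definition ndp_path1 (n : nat) : seq int :=
  rcons [seq Posz i | i <- iota 1 n] (- 1)%R.

Definition ndp_path2 (n : nat) : seq int :=
  [seq (- Posz i)%R | i <- iota 2 n.-1].

Definition consecutive (s : seq int) (x y : int) : bool :=
  (x, y) \in zip s (behead s).

(* For n = 1 this makes 1 and -1 adjacent, which has no effect on the tubes
   and tubings below since neither of them may contain both 1 and -1. *)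
Definition ndp_adj n : rel (pm n) := fun u v =>
  let x := pm_int u in let y := pm_int v in
  [|| consecutive (ndp_path1 n) x y, consecutive (ndp_path1 n) y x,
      consecutive (ndp_path2 n) x y | consecutive (ndp_path2 n) y x].

Definition ndp_tube n (A : {set pm n}) : bool :=
  [&& A != finset.set0, induces_connected (@ndp_adj n) A & no_antipodal A].

Definition ndp_tubing n (S : {set {set pm n}}) : bool :=
  [&& [forall A in S, ndp_tube A], pairwise_compatible (@ndp_adj n) S
    & no_antipodal (finset.cover S)].

Definition cycle_adj n : rel 'I_n.+1 := fun i j =>
  (j == ordS i) || (i == ordS j).

Definition cycle_tube n (A : {set 'I_n.+1}) : bool :=
  [&& A != finset.set0, A != [set: 'I_n.+1] & induces_connected (@cycle_adj n) A].

Definition cycle_tubing n (S : {set {set 'I_n.+1}}) : bool :=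
  [forall A in S, cycle_tube A] && pairwise_compatible (@cycle_adj n) S.

Local Open Scope classical_set_scope.
Local Open Scope ring_scope.

Section Polytopes.
Variables (R : realType) (d : nat).
Implicit Types (P F : set 'rV[R]_d) (n k : nat).

Definition is_polytope P : Prop :=
  exists (m : nat) (V : 'I_m -> 'rV[R]_d),
    P = [set x | exists t : 'I_m -> R,
          [/\ forall i, 0 <= t i, \sum_i t i = 1 & x = \sum_i t i *: V i]].

(* With c = 0 this includes P itself and the empty face. *)
Definition is_face P F : Prop :=
  exists (c : 'cV[R]_d) (b : R),
    (forall x, P x -> (x *m c) 0 0 <= b) /\
    F = P `&` [set x | (x *m c) 0 0 = b].

Definition affine_independent k (p : 'I_k.+1 -> 'rV[R]_d) : bool :=
  row_free (\matrix_(i < k) (p (lift ord0 i) - p ord0)).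

(* False for every k when F is empty. *)
Definition has_dim F k : Prop :=
  (exists2 p : 'I_k.+1 -> 'rV[R]_d,
     affine_independent p & forall i, F (p i)) /\
  ~ (exists2 p : 'I_k.+2 -> 'rV[R]_d,
     affine_independent p & forall i, F (p i)).

Definition faces_of_dim P k : set (set 'rV[R]_d) :=
  [set F | is_face P F /\ has_dim F k].

Definition f_vector n P : {ffun 'I_n.+1 -> nat} :=
  [ffun k : 'I_n.+1 => #|` fset_set (faces_of_dim P k)|].

(* The facets of P, when P has dimension n > 0. *)
Definition facets n P : set (set 'rV[R]_d) := faces_of_dim P n.-1.

Definition simple_polytope n P : Prop :=
  [/\ is_polytope P, has_dim P n
    & forall v, faces_of_dim P 0 v ->
        ([set F | facets n P F /\ v `<=` F] #= `I_n)%card].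

Definition dual_complex n P : set (set (set 'rV[R]_d)) :=
  [set S | S `<=` facets n P /\ (P `&` \bigcap_(F in S) F) !=set0].

Definition is_ndp_associahedron n P : Prop :=
  simple_polytope n P /\
  exists phi : {set pm n} -> set 'rV[R]_d,
    set_bij [set A | ndp_tube A] (facets n P) phi /\
    forall S : {set {set pm n}}, (forall A, A \in S -> ndp_tube A) ->
      (ndp_tubing S <-> dual_complex n P (phi @` [set` S])).

Definition is_cyclohedron n P : Prop :=
  simple_polytope n P /\
  exists psi : {set {set 'I_n.+1}} -> set 'rV[R]_d,
    [/\ set_bij [set S | cycle_tubing S]
          [set F | is_face P F /\ F !=set0] psi,
        forall S S', cycle_tubing S -> cycle_tubing S' ->
          (S \subset S' <-> psi S' `<=` psi S)
      & forall S, cycle_tubing S ->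
          exists2 m : nat, (m + #|S|)%N = n & has_dim (psi S) m].

End Polytopes.

(* Main.v *)
(* Both sides count cliques of a compatibility relation on tubes. In a simple
   polytope the faces of dimension k correspond to the sets of n - k facets with
   nonempty intersection: at a vertex the cone of valid linear functionals is
   generated by the n facet functionals, which form a basis.

   The tubes of either graph are encoded as signed intervals. The generating
   polynomial of the near double path tubings is first shown to be that of two
   disjoint paths: the polynomials of tubings avoiding 1, avoiding -1 and
   avoiding both agree for the two graphs, a reflection exchanging the
   first two. The polynomials X_n of the two paths and of the cycle then satisfy
   the same recursion X_n = P_n + t * \sum P_i P_j X_k over i + j + k = n - 1,
   where P_m counts the tubings of a path with m vertices; it comes from
   contracting one distinguished tube of the tubing. *)
Require Import Defs.
From mathcomp Require Import all_boot all_order all_algebra.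
From mathcomp Require Import zify ring lra.

Set Implicit Arguments.
Unset Strict Implicit.
Unset Printing Implicit Defensive.
Import Order.TTheory GRing.Theory Num.Theory.

(** * Clique polynomials *)

(** No map between the tubings of the two graphs is built; only generating polynomials are compared.
    The obstacle on the near double path is the pair [1], [-1] at the two ends of one path. A tubing
    meets at most one of them, so inclusion-exclusion leaves only tubings in which that path has
    lost an end, and these fit into two paths facing each other. In the recursion the distinguished
    tube leaves three independent regions. On two paths they are the other path to its left, its own
    vertices after the first (it is the smallest with that start), and both paths to its right. On
    the cycle they are the two sides of [0] inside the tube, which is the smallest through [0], and
    the cycle outside it. On the geometric side simplicity only counts the facets through a vertex,
    so independence of their functionals has to be derived. A vertex is exposed strictly, so the
    valid functionals fill a neighbourhood of one of them and span an [n]-dimensional space; [n]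
    generators of that space form a basis. *)

Section CliquePolynomial.
Variables (T : finType) (r : rel T).
Implicit Types (X Y Z S : {set T}).

Definition clique S : bool := [forall x in S, forall y in S, r x y].

Definition clique_poly X : {poly int} :=
  (\sum_(S : {set T} | (S \subset X) && clique S) 'X^#|S|)%R.

Lemma cliqueP S : reflect {in S &, forall x y, r x y} (clique S).
Proof.
apply: (iffP forall_inP) => [H x y xS yS|H x xS].
  by move/forall_inP: (H x xS); apply.
by apply/forall_inP => y yS; apply: H.
Qed.

Lemma coef_clique_poly X k :
  ((clique_poly X)`_k = Posz #|[set S : {set T} | [&& S \subset X, clique S & #|S| == k]]|)%R.
Proof.
rewrite /clique_poly coef_sum -sum1_card [RHS](@big_morph _ _ Posz 0%R +%R) //=.
rewrite [RHS](eq_bigl (fun S : {set T} => ((S \subset X) && clique S) && (#|S| == k)));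
  last by move=> S; rewrite inE andbA.
rewrite [RHS]big_mkcondr; apply: eq_bigr => S _.
by rewrite coefXn eq_sym; case: eqP.
Qed.

Lemma clique_poly0 : clique_poly set0 = 1%R.
Proof.
rewrite /clique_poly (big_pred1 set0) ?cards0 ?expr0 // => S /=.
rewrite subset0; case: eqP => //= ->; apply/cliqueP => x y; by rewrite inE.
Qed.

Hypotheses (rxx : reflexive r) (rC : symmetric r).

Definition link X x := [set y in X | (y != x) && r x y].

(** Deletion and link in a flag complex: removing [x] turns a clique through [x] into a clique of
    its neighbours. *)
Lemma clique_poly_split X x : x \in X ->
  clique_poly X = (clique_poly (X :\ x) + 'X * clique_poly (link X x))%R.
Proof.
move=> xX; rewrite /clique_poly (bigID (fun S : {set T} => x \in S)) /= addrC.
congr (_ + _)%R.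
  by apply: eq_bigl => S; rewrite subsetD1; case: (_ \subset _); case: (clique S);
     case: (x \in S).
rewrite big_distrr /= (reindex_onto (fun S => x |: S) (fun S => S :\ x)) /=; last first.
  by move=> S /andP[_ xS]; rewrite setD1K.
apply: eq_big => S; last first.
  move=> /andP[_ /eqP E]; have xS : x \notin S by rewrite -E !inE eqxx.
  by rewrite -exprS cardsU1 xS.
rewrite setU11 andbT; case: (boolP (x \in S)) => xS.
  rewrite (_ : _ == S = false) ?andbF; last first.
    by apply/negP => /eqP E; move: xS; rewrite -E !inE eqxx.
  symmetry; apply/negP => /andP[/subsetP/(_ x xS)].
  by rewrite inE eqxx andbF.
rewrite setU1K // eqxx andbT; apply/andP/andP.
  move=> [/subsetP SX /cliqueP cS]; split; last first.
    by apply/cliqueP => y z yS zS; apply: cS; apply: setU1r.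
  apply/subsetP => y yS; rewrite inE SX ?setU1r //=.
  rewrite cS ?setU11 ?setU1r // andbT; by apply: contraNneq xS => <-.
move=> [/subsetP SX /cliqueP cS]; split.
  apply/subsetP => y; rewrite !inE => /orP[/eqP -> //|/SX].
  by rewrite inE => /andP[].
apply/cliqueP => y z; rewrite !inE => /orP[/eqP ->|yS] /orP[/eqP ->|zS] //.
- by have := SX _ zS; rewrite inE => /and3P[].
- by have := SX _ yS; rewrite rC inE => /and3P[].
- exact: cS.
Qed.

(** The join of two complexes: vertices of [X] are peeled off one at a time, and as all of [X] is
    compatible with [Y], deletion and link both keep [Y] whole. *)
Lemma clique_polyM X Y : [disjoint X & Y] ->
  {in X & Y, forall x y, r x y} ->
  clique_poly (X :|: Y) = (clique_poly X * clique_poly Y)%R.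
Proof.
elim: {X}#|X| {-2}X (leqnn #|X|) => [|k IH] X; last first.
  case: (set_0Vmem X) => [->|[x xX] leX dXY rXY].
    by move=> _ _ _; rewrite set0U clique_poly0 mul1r.
  have xY : x \notin Y by apply: contraTN dXY => xY; apply/pred0Pn; exists x; rewrite /= xX.
  rewrite (@clique_poly_split (X :|: Y) x) ?inE ?xX //.
  rewrite (clique_poly_split xX) mulrDl.
  have cD : #|X :\ x| <= k by move: leX; rewrite (cardsD1 x X) xX.
  have -> : (X :|: Y) :\ x = (X :\ x) :|: Y.
    by rewrite setDUl; congr (_ :|: _); apply/setDidPl; rewrite disjoint_sym disjoints1.
  have -> : link (X :|: Y) x = link X x :|: Y.
    apply/setP => y; rewrite !inE; case: (boolP (y \in Y)) => yY; last by rewrite !orbF.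
    rewrite !orbT /= rXY // andbT.
    by apply: contraNneq xY => <-.
  rewrite IH ?IH ?mulrA //.
  - apply: leq_trans cD; apply: subset_leq_card; apply/subsetP => y.
    by rewrite !inE => /and3P[-> -> _].
  - by apply: disjointWl dXY; apply/subsetP => y; rewrite !inE => /andP[].
  - by move=> y z; rewrite !inE => /andP[yX _] zY; apply: rXY.
  - by apply: disjointWl dXY; rewrite subD1set.
  - by move=> y z; rewrite !inE => /andP[_ yX] zY; apply: rXY.
by rewrite leqn0 cards_eq0 => /eqP -> _ _; rewrite set0U clique_poly0 mul1r.
Qed.

(* Cliques meeting [Y] are sorted by their element of [Y] of smallest key. *)
Lemma clique_poly_min (key : T -> nat) X Y : Y \subset X -> {in Y &, injective key} ->
  clique_poly X = (clique_poly (X :\: Y) + \sum_(x in Y)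
    'X * clique_poly [set y in link X x | (y \in Y) ==> (key x < key y)%N])%R.
Proof.
move=> + injk.
elim: {Y}#|Y| {-2}Y (leqnn #|Y|) injk X => [|k IH] Y leY injk X YX; last first.
  case: (set_0Vmem Y) => [->|[x0 x0Y]]; first by rewrite setD0 big_set0 addr0.
  case: (@arg_minnP _ x0 [in Y] key x0Y) => x xY minx.
  have xX : x \in X by apply: (subsetP YX).
  rewrite (clique_poly_split xX) (IH (Y :\ x)); first last.
  - by apply: setSD.
  - by move=> y z; rewrite !inE => /andP[_ yY] /andP[_ zY]; apply: injk.
  - by move: leY; rewrite (cardsD1 x Y) xY.
  have -> : (X :\ x) :\: (Y :\ x) = X :\: Y.
    by apply/setP => y; rewrite !inE; case: eqP => // ->; rewrite xY.
  rewrite -addrA; congr (_ + _)%R.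
  rewrite [RHS](bigD1 x) //= addrC; congr (_ + _)%R.
    congr (_ * clique_poly _)%R; apply/setP => y; rewrite !inE.
    case: (boolP (y \in Y)) => yY; rewrite ?andbT //=.
    case: (altP (y =P x)) => yx //=; first by rewrite andbF.
    rewrite (_ : (key x < key y)%N) ?andbT // ltn_neqAle minx // andbT.
    by apply: contraNneq yx => /(injk _ _ xY yY) ->.
  apply: eq_big => y; first by rewrite !inE andbC.
  rewrite !inE => /andP[yx yY]; congr (_ * clique_poly _)%R.
  apply/setP => z; rewrite !inE; case: (altP (z =P x)) => [->|zx] //=.
  by rewrite xY ltnNge (minx _ yY) !andbF.
by move: leY; rewrite leqn0 cards_eq0 => /eqP ->; rewrite setD0 big_set0 addr0.
Qed.

(** No clique meets both [Y] and [Z], so inclusion-exclusion holds already for the contribution of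
    each single clique. *)
Lemma clique_poly_incompatible X Y Z : Y \subset X -> Z \subset X ->
  {in Y & Z, forall y z, ~~ r y z} ->
  clique_poly X = (clique_poly (X :\: Y) + clique_poly (X :\: Z)
                   - clique_poly (X :\: (Y :|: Z)))%R.
Proof.
move=> YX ZX nYZ; apply/eqP; rewrite -subr_eq opprK; apply/eqP.
pose w (U S : {set T}) : {poly int} := if S \subset U then 'X^#|S|%R else 0%R.
have E U : clique_poly U = (\sum_(S | clique S) w U S)%R.
  by rewrite /clique_poly -big_mkcondr; apply: eq_bigl => S; rewrite andbC.
rewrite !E -!big_split /=; apply: eq_bigr => S /cliqueP cS.
rewrite /w setDUr subsetI !subsetD; case: (S \subset X) => //=.
case: (boolP [disjoint S & Y]) => dY; case: (boolP [disjoint S & Z]) => dZ //=.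
- by rewrite addrC.
- exfalso; move/pred0Pn: dY => [y /andP[/= yS yY]]; move/pred0Pn: dZ => [z /andP[/= zS zZ]].
  by have := nYZ _ _ yY zZ; rewrite cS.
Qed.

End CliquePolynomial.

Lemma clique_poly_iso (T T' : finType) (r : rel T) (r' : rel T') (f : T -> T')
    (X : {set T}) :
  {in X &, injective f} -> {in X &, forall x y, r' (f x) (f y) = r x y} ->
  clique_poly r' (f @: X) = clique_poly r X.
Proof.
move=> injf rf; rewrite /clique_poly.
rewrite (reindex_onto (fun S : {set T} => f @: S)
                      (fun S' => [set x in X | f x \in S'])) /=; last first.
  move=> S' /andP[/subsetP S'X _]; apply/setP => y; apply/imsetP/idP.
    by move=> [x]; rewrite inE => /andP[_ fxS] ->.
  by move=> yS'; have /imsetP[x xX E] := S'X _ yS'; exists x; rewrite // inE xX -E.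
have key (S : {set T}) : S \subset X -> [set x in X | f x \in f @: S] = S.
  move=> /subsetP SX; apply/setP => x; rewrite inE; apply/andP/idP.
    by move=> [xX /imsetP[y yS /injf E]]; rewrite E // SX.
  by move=> xS; rewrite SX // imset_f.
apply: eq_big => [S|S /andP[_ /eqP E]]; last first.
  rewrite card_in_imset // => x y xS yS; apply: injf.
    by move: xS; rewrite -E inE => /andP[].
  by move: yS; rewrite -E inE => /andP[].
apply/andP/andP => [[/andP[_ /cliqueP cS] /eqP E]|[SX /cliqueP cS]].
  have SX : S \subset X by rewrite -E; apply/subsetP => x; rewrite inE => /andP[].
  split=> //; apply/cliqueP => x y xS yS.
  by rewrite -rf ?(subsetP SX) // cS ?imset_f.
split; last by rewrite key.
rewrite imsetS //=; apply/cliqueP => _ _ /imsetP[x xS ->] /imsetP[y yS ->].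
by rewrite rf ?(subsetP SX) // cS.
Qed.

(* [(s, (a, b))] stands for the interval [a, b] with sign [s]. *)
Definition sint : Type := (bool * (nat * nat))%type.

Section SignedIntervals.
Variable N : nat.

(** Sums over cliques need a finite type, while endpoint arithmetic is done in [nat]; [N] is only a
    ceiling, and [bounded] guarantees that it cuts nothing off. *)
Definition bsint : finType := (bool * ('I_N.+1 * 'I_N.+1))%type.

Definition unbound (x : bsint) : sint := (x.1, (val x.2.1, val x.2.2)).
Definition bound (x : sint) : bsint := (x.1, (inord x.2.1, inord x.2.2)).

Definition bounded (q : pred sint) :=
  forall s a b, q (s, (a, b)) -> (a <= N)%N /\ (b <= N)%N.

Lemma unbound_inj : injective unbound.
Proof. by move=> [s [a b]] [s' [a' b']] [-> /ord_inj -> /ord_inj ->]. Qed.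

Lemma unboundK : cancel unbound bound.
Proof. by move=> [s [a b]]; rewrite /bound /= !inord_val. Qed.

Lemma boundK (q : pred sint) : bounded q -> {in q, cancel bound unbound}.
Proof. by move=> bq [s [a b]] /bq [aN bN]; rewrite /unbound /= !inordK. Qed.

Definition sset (q : pred sint) : {set bsint} := [set x | q (unbound x)].

Variable r : rel sint.
Definition srel : rel bsint := fun x y => r (unbound x) (unbound y).

Definition spoly (q : pred sint) := clique_poly srel (sset q).

End SignedIntervals.

Lemma clique_poly_sset (N : nat) (T : finType) (r : rel sint) (r' : rel T)
    (q : pred sint) (f : sint -> T) : bounded N q ->
  {in q &, injective f} -> {in q &, forall x y, r' (f x) (f y) = r x y} ->
  clique_poly r' [set f (unbound x) | x in sset N q] = spoly N r q.
Proof.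
move=> bq injf rf; apply: (@clique_poly_iso _ _ _ _ (f \o @unbound N)).
  by move=> x y; rewrite !inE => qx qy /= /injf /unbound_inj ->.
by move=> x y; rewrite !inE => qx qy /=; apply: rf.
Qed.

Lemma spoly_iso N (r r' : rel sint) (q q' : pred sint) (g h : sint -> sint) :
  bounded N q -> bounded N q' ->
  (forall x, q x -> q' (g x) /\ h (g x) = x) ->
  (forall x, q' x -> q (h x) /\ g (h x) = x) ->
  (forall x y, q x -> q y -> r' (g x) (g y) = r x y) ->
  spoly N r q = spoly N r' q'.
Proof.
move=> bq bq' gP hP rg.
rewrite -(@clique_poly_sset N _ r (srel r') q (fun x => bound N (g x))) //.
- congr clique_poly; apply/setP => x; rewrite inE; apply/imsetP/idP.
    move=> [y]; rewrite inE => qy ->; rewrite (boundK bq') ?unfold_in; by case: (gP _ qy).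
  move=> /hP[qh gh]; exists (bound N (h (unbound x))).
    by rewrite inE (boundK bq).
  by rewrite (boundK bq) // gh unboundK.
- move=> x y qx qy /(congr1 (@unbound N)).
  have [q'x hgx] := gP _ qx; have [q'y hgy] := gP _ qy.
  by rewrite !(boundK bq') // => /(congr1 h); rewrite hgx hgy.
- move=> x y qx qy; rewrite /srel.
  have [q'x _] := gP _ qx; have [q'y _] := gP _ qy.
  by rewrite !(boundK bq') // rg.
Qed.

Lemma eq_spoly N (r r' : rel sint) (q q' : pred sint) : q =1 q' ->
  (forall x y, q x -> q y -> r' x y = r x y) -> spoly N r q = spoly N r' q'.
Proof.
move=> qq' rr'.
have -> : spoly N r' q' = spoly N r' q.
  by congr clique_poly; apply/setP => x; rewrite !inE qq'.
rewrite /spoly /clique_poly; apply: eq_bigl => S.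
case: (boolP (S \subset _)) => //= /subsetP SX.
apply/cliqueP/cliqueP => H x y xS yS; have := H x y xS yS;
  have := SX _ xS; have := SX _ yS; rewrite !inE => qy qx; rewrite /srel.
  by rewrite rr'.
by rewrite rr'.
Qed.

Lemma spolyM N (r : rel sint) (q qa qb : pred sint) :
  reflexive r -> symmetric r ->
  q =1 predU qa qb ->
  (forall x y, qa x -> qb y -> r x y && (x != y)) ->
  spoly N r q = (spoly N r qa * spoly N r qb)%R.
Proof.
move=> rxx rC qE qab; rewrite -clique_polyM.
- by congr clique_poly; apply/setP => x; rewrite !inE qE.
- by move=> x; apply: rxx.
- by move=> x y; apply: rC.
- apply/pred0P => x /=; rewrite !inE; apply/negP => /andP[a b].
  by have /andP[_] := qab _ _ a b; rewrite eqxx.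
- by move=> x y; rewrite !inE => a b; case/andP: (qab _ _ a b).
Qed.

Lemma spoly_min N (r : rel sint) (q q0 : pred sint) (key : sint -> nat) :
  reflexive r -> symmetric r ->
  subpred q0 q -> (forall x y, q0 x -> q0 y -> key x = key y -> x = y) ->
  spoly N r q = (spoly N r (predD q q0) + \sum_(x in sset N q0)
    'X * spoly N r (fun y => [&& q y, y != unbound x, r (unbound x) y
                              & q0 y ==> (key (unbound x) < key y)%N]))%R.
Proof.
move=> rxx rC sq injk.
rewrite /spoly (@clique_poly_min _ _ _ _ (key \o @unbound N) (sset N q) (sset N q0)).
- congr (clique_poly _ _ + _)%R; first by apply/setP => x; rewrite !inE.
  apply: eq_bigr => x; rewrite inE => q0x; congr (_ * clique_poly _ _)%R.
  apply/setP => y; rewrite !inE (inj_eq (@unbound_inj N)) -!andbA.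
  by [].
- by move=> x; apply: rxx.
- by move=> x y; apply: rC.
- by apply/subsetP => x; rewrite !inE; apply: sq.
- move=> x y; rewrite !inE => qx qy /= /injk E; apply: (@unbound_inj N); exact: E.
Qed.

(** * Signed intervals *)

Definition nested (I J : nat * nat) : bool :=
  (I.1 <= J.1) && (J.2 <= I.2) || (J.1 <= I.1) && (I.2 <= J.2).

Definition apart (I J : nat * nat) : bool := (I.2.+1 < J.1) || (J.2.+1 < I.1).

Definition disjoint_itv (I J : nat * nat) : bool := (I.2 < J.1) || (J.2 < I.1).

Definition inside (I J : nat * nat) : bool := (J.1 < I.1) && (I.2 < J.2).

(* The signs distinguish two copies of a path; a tubing never uses both copies
   of a vertex. *)
Definition dpath_rel : rel sint := fun x y =>
  if x.1 == y.1 then nested x.2 y.2 || apart x.2 y.2 else disjoint_itv x.2 y.2.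

(* Negative intervals stand for complements, so two of them are never disjoint
   as tubes. *)
Definition cycle_rel : rel sint := fun x y =>
  match x.1, y.1 with
  | true, true => nested x.2 y.2 || apart x.2 y.2
  | true, false => disjoint_itv x.2 y.2 || inside x.2 y.2
  | false, true => disjoint_itv x.2 y.2 || inside y.2 x.2
  | false, false => nested x.2 y.2
  end.

(** The sign is free: under [dpath_rel] these are the tubes of two paths on [lo, ..., hi - 1], under
    [cycle_rel] those of a cycle with one further vertex. *)
Definition within (lo hi : nat) : pred sint :=
  fun x => [&& lo <= x.2.1, x.2.1 <= x.2.2 & x.2.2 < hi].

Definition signed (s : bool) (lo hi : nat) : pred sint :=
  fun x => (x.1 == s) && within lo hi x.

Ltac sint_lia :=
  rewrite /signed /within /dpath_rel /cycle_rel /nested /apart /disjoint_itv /inside /=;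
  try lia.

Lemma dpath_relxx : reflexive dpath_rel.
Proof. by move=> [s [a b]]; rewrite /dpath_rel eqxx /nested !leqnn. Qed.

Lemma dpath_relC : symmetric dpath_rel.
Proof. by move=> [[] [a b]] [[] [c d]]; sint_lia. Qed.

Lemma cycle_relxx : reflexive cycle_rel.
Proof. by move=> [[] [a b]]; sint_lia. Qed.

Lemma cycle_relC : symmetric cycle_rel.
Proof. by move=> [[] [a b]] [[] [c d]]; sint_lia. Qed.

(** * The common recursion of two paths and of the cycle *)

Section Recursion.
Variable N : nat.

Lemma signed_shift (s s' : bool) lo hi lo' hi' : hi <= N.+1 -> hi' <= N.+1 ->
  hi - lo = hi' - lo' ->
  spoly N dpath_rel (signed s lo hi) = spoly N dpath_rel (signed s' lo' hi').
Proof.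
move=> hN hN' E.
apply: (@spoly_iso _ _ _ _ _
  (fun x => (s', (x.2.1 - lo + lo', x.2.2 - lo + lo')))
  (fun x => (s, (x.2.1 - lo' + lo, x.2.2 - lo' + lo)))).
- by move=> t a b; sint_lia.
- by move=> t a b; sint_lia.
- move=> [t [a b]]; sint_lia => H; split; first by lia.
  by congr (_, (_, _)); lia.
- move=> [t [a b]]; sint_lia => H; split; first by lia.
  by congr (_, (_, _)); lia.
- by move=> [t [a b]] [t' [c d]]; rewrite /signed /= => /andP[/eqP -> H] /andP[/eqP -> H'];
    move: H H'; rewrite /dpath_rel /= !eqxx; sint_lia.
Qed.

Lemma within_shift lo hi lo' hi' : hi <= N.+1 -> hi' <= N.+1 ->
  hi - lo = hi' - lo' ->
  spoly N dpath_rel (within lo hi) = spoly N dpath_rel (within lo' hi').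
Proof.
move=> hN hN' E.
apply: (@spoly_iso _ _ _ _ _
  (fun x => (x.1, (x.2.1 - lo + lo', x.2.2 - lo + lo')))
  (fun x => (x.1, (x.2.1 - lo' + lo, x.2.2 - lo' + lo)))).
- by move=> t a b; sint_lia.
- by move=> t a b; sint_lia.
- move=> [t [a b]]; sint_lia => H; split; first by lia.
  by congr (_, (_, _)); lia.
- move=> [t [a b]]; sint_lia => H; split; first by lia.
  by congr (_, (_, _)); lia.
- by move=> [[] [a b]] [[] [c d]]; sint_lia.
Qed.

(* The contracted tube is the smallest negative one starting at the leftmost
   negative vertex. *)
Lemma dpath_rec lo hi : hi <= N.+1 ->
  spoly N dpath_rel (within lo hi) = (spoly N dpath_rel (signed true lo hi) +
    \sum_(x in sset N (signed false lo hi))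
      'X * (spoly N dpath_rel (signed true lo x.2.1)
          * spoly N dpath_rel (signed false x.2.1.+1 x.2.2.+1)
          * spoly N dpath_rel (within x.2.2.+1 hi)))%R.
Proof.
move=> hN.
(* Right ends stay below [N.+2], so the key compares left ends first, then right ends. *)
rewrite (@spoly_min _ _ _ (signed false lo hi) (fun x => x.2.1 * N.+2 + x.2.2)); first last.
- move=> [s [a b]] [s' [c d]] /=; rewrite /signed /=.
  move=> /andP[/eqP -> H] /andP[/eqP -> H']; move: H H'; sint_lia => H H' E.
  have ac : a = c by nia.
  by congr (_, (_, _)); nia.
- by move=> x /andP[].
- exact: dpath_relC.
- exact: dpath_relxx.
congr (_ + _)%R.
  by apply: eq_spoly => // -[[] [a b]]; sint_lia.
apply: eq_bigr => -[s [i l]]; rewrite inE /signed /unbound /= => /andP[/eqP -> {s}].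
move: i l => [i hi'] [l hl] /=; rewrite /within /= => il; congr (_ * _)%R.
(* The negative tubes of [C] that start at [i] contain [[i, l]]; deleting [[i, l]] makes them start
   at [l.+1], a start that adjacency to [[i, l]] otherwise forbids. This turns [C] into two full
   paths to the right of [l]. *)
pose C : pred sint := fun y => if y.1 then within l.+1 hi y
  else (y.2.2 < hi) && ((y.2.1 == i) && (l < y.2.2) || (l.+1 < y.2.1 <= y.2.2)).
pose A := signed true lo i; pose B := signed false i.+1 l.+1.
rewrite (@spolyM _ _ _ (predU A B) C).
- rewrite (@spolyM _ _ _ A B).
  + congr (_ * _)%R.
    apply: (@spoly_iso _ _ _ _ _
      (fun x => if x.1 then x else (x.1, (maxn l.+1 x.2.1, x.2.2)))
      (fun x => if x.1 then x else (x.1, (if x.2.1 == l.+1 then i else x.2.1, x.2.2)))).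
    * by move=> [] a b; rewrite /C; sint_lia.
    * by move=> [] a b; rewrite /C; sint_lia.
    * move=> [[] [a b]]; rewrite /C; sint_lia => H.
        by split=> //; lia.
      split; first lia.
      by congr (_, (_, _)); case: ifP; lia.
    * move=> [[] [a b]]; rewrite /C; sint_lia => H.
        by split=> //; lia.
      split; first by case: ifP; lia.
      by congr (_, (_, _)); case: ifP; lia.
    * by move=> [[] [a b]] [[] [c d]]; rewrite /C; sint_lia.
  + exact: dpath_relxx.
  + exact: dpath_relC.
  + by move=> ?.
  + by move=> [[] [a b]] [[] [c d]]; rewrite /A /B; sint_lia;
      rewrite ?andbT //; sint_lia.
- exact: dpath_relxx.
- exact: dpath_relC.
- move=> [[] [a b]]; rewrite /A /B /C /predU /=; sint_lia.
  rewrite -pair_eqE /= -pair_eqE /=; nia.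
- by move=> [[] [a b]] [[] [c d]]; rewrite /A /B /C /predU -?pair_eqE /= -?pair_eqE /=; sint_lia.
Qed.

End Recursion.

Section Recursion.
Variable N : nat.

(* The contracted tube is the smallest one containing [0], that is, the outermost
   negative interval [a, b]; the resulting cycle is cut anew at [a]. *)
Lemma cycle_rec lo hi : hi <= N.+1 ->
  spoly N cycle_rel (within lo hi) = (spoly N dpath_rel (signed true lo hi) +
    \sum_(x in sset N (signed false lo hi))
      'X * (spoly N dpath_rel (signed true lo x.2.1)
          * spoly N dpath_rel (signed true x.2.2.+1 hi)
          * spoly N cycle_rel (within x.2.1.+1 x.2.2.+1)))%R.
Proof.
move=> hN.
(* Compatible negative intervals are nested, so the least left end, then the largest right end
   (hence [N - x.2.2]), selects the outermost one. *)
rewrite (@spoly_min _ _ _ (signed false lo hi)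
  (fun x => x.2.1 * N.+2 + (N - x.2.2))); first last.
- move=> [s [a b]] [s' [c d]] /=; rewrite /signed /=.
  move=> /andP[/eqP -> H] /andP[/eqP -> H']; move: H H'; sint_lia => H H' E.
  have ac : a = c by nia.
  by congr (_, (_, _)); nia.
- by move=> x /andP[].
- exact: cycle_relC.
- exact: cycle_relxx.
congr (_ + _)%R.
  apply: eq_spoly => [[[] [a b]]|[[] [a b]] [[] [c d]]]; by sint_lia.
apply: eq_bigr => -[s [a b]]; rewrite inE /signed /unbound /= => /andP[/eqP -> {s}].
move: a b => [a ha] [b hb] /=; rewrite /within /= => ab; congr (_ * _)%R.
(* [A] and [B] lie inside the contracted tube, on either side of [0]; the members of [C] contain
   that tube or are apart from it. *)
pose C : pred sint := fun y => if y.1 then [&& a < y.2.1, y.2.1 <= y.2.2 & y.2.2 < b]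
  else [&& a <= y.2.1, y.2.1 <= y.2.2, y.2.2 <= b & (a < y.2.1) || (y.2.2 < b)].
pose A := signed true lo a; pose B := signed true b.+1 hi.
rewrite (@spolyM _ _ _ (predU A B) C).
- rewrite (@spolyM _ _ _ A B).
  + congr (_ * _ * _)%R.
    * by apply: eq_spoly => // [[[] [c d]]] [[] [e f]]; sint_lia.
    * by apply: eq_spoly => // [[[] [c d]]] [[] [e f]]; sint_lia.
    (* Deleting the contracted tube from a tube containing it leaves an arc of the cycle
       [a, ..., b]. If the complement starts at [a], this arc is an interval ending at [b] and
       becomes positive; otherwise it contains the new base point [a] and stays negative. *)
    apply: (@spoly_iso _ _ _ _ _
      (fun x => if ~~ x.1 && (x.2.1 == a) then (true, (x.2.2.+1, b)) else x)
      (fun x => if x.1 && (x.2.2 == b) then (false, (a, x.2.1.-1)) else x)).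
    * by move=> [] c d; rewrite /C; sint_lia.
    * by move=> [] c d; rewrite /C; sint_lia.
    * move=> [[] [c d]]; rewrite /C; sint_lia => H.
        by rewrite (_ : (d == b) = false); [split=> //; lia | lia].
      case: eqP => ca /=; last by split=> //; lia.
      rewrite eqxx; split; first by lia.
      by congr (_, (_, _)); lia.
    * move=> [[] [c d]]; rewrite /C; sint_lia => H.
        case: eqP => db /=; last by split=> //; lia.
        rewrite eqxx; split; first by lia.
        by congr (_, (_, _)); lia.
      by rewrite (_ : (c == a) = false); [split=> //; lia | lia].
    * move=> [[] [c d]] [[] [e f]]; rewrite /C /=; repeat case: eqP => ? /=; by sint_lia.
  + exact: cycle_relxx.
  + exact: cycle_relC.
  + by move=> ?.
  + by move=> [[] [c d]] [[] [e f]]; rewrite /A /B -?pair_eqE /= -?pair_eqE /=; sint_lia.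
- exact: cycle_relxx.
- exact: cycle_relC.
- move=> [[] [c d]]; rewrite /A /B /C /predU /=; sint_lia.
  rewrite -pair_eqE /= -pair_eqE /=; nia.
- by move=> [[] [c d]] [[] [e f]]; rewrite /A /B /C /predU -?pair_eqE /= -?pair_eqE /=; sint_lia.
Qed.

Lemma cycle_dpath lo hi : hi <= N.+1 ->
  spoly N cycle_rel (within lo hi) = spoly N dpath_rel (within lo hi).
Proof.
have [m] := ubnP (hi - lo); elim: m lo hi => // m IH lo hi lem hN.
rewrite cycle_rec // dpath_rec //; congr (_ + _)%R.
(* The first factors agree; reflecting the right end swaps the lengths [b - a] and [hi.-1 - b],
   which the two recursions give to different factors. [minn N] keeps off-range values below [N.+1],
   as [inordK] requires. *)
pose rev (x : bsint N) := bound N (x.1, (val x.2.1, minn N (x.2.1 + hi.-1 - x.2.2))).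
have minN k : minn N k < N.+1 by lia.
rewrite [RHS](reindex_onto rev rev) /=; last first.
  move=> [s [[a ha] [b hb]]]; rewrite !inE /rev /signed /within /bound /= => H.
  by congr (_, (_, _)); apply: val_inj; rewrite /= !(inordK ha) ?inordK ?minN //; lia.
apply: eq_big => [x|[s [[a ha] [b hb]]]].
  move: x => [s [[a ha] [b hb]]]; rewrite !inE /rev /signed /within /bound /=.
  rewrite -!pair_eqE /= -!pair_eqE /= -!val_eqE /= !(inordK ha) !inordK ?minN //.
  lia.
rewrite !inE /rev /signed /within /bound /= => H.
rewrite (inordK ha) inordK ?minN //.
rewrite IH; [|lia|lia]; congr (_ * (_ * _ * _))%R.
  by apply: signed_shift; lia.
by apply: within_shift; lia.
Qed.

End Recursion.

(** * From the near double path to two disjoint paths *)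

Lemma spoly_incompatible N (r : rel sint) (q qy qz : pred sint) :
  subpred qy q -> subpred qz q ->
  (forall y z, qy y -> qz z -> ~~ r y z) ->
  spoly N r q = (spoly N r (predD q qy) + spoly N r (predD q qz)
                 - spoly N r (predD q (predU qy qz)))%R.
Proof.
move=> yq zq nyz.
rewrite /spoly (@clique_poly_incompatible _ _ (sset N q) (sset N qy) (sset N qz)).
- by congr (_ + _ - _)%R; congr clique_poly; apply/setP => x; rewrite !inE.
- by apply/subsetP => x; rewrite !inE; apply: yq.
- by apply/subsetP => x; rewrite !inE; apply: zq.
- by move=> x y; rewrite !inE; apply: nyz.
Qed.

(* Signs record the path; on the first path the vertex [-1] has position
   [n + 1], on the second one [-i] has position [i]. *)
Definition ndp_itv (n : nat) : pred sint := fun x =>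
  if x.1 then [&& 0 < x.2.1, x.2.1 <= x.2.2, x.2.2 <= n.+1
                & (1 < x.2.1) || (x.2.2 <= n)]
  else [&& 1 < x.2.1, x.2.1 <= x.2.2 & x.2.2 <= n].

(** The extra clause excludes the pair [1], [-1], at positions [1] and [n.+1] of the first path.
    Nested intervals need no such test: the larger one would contain both, against [ndp_itv]. *)
Definition ndp_rel (n : nat) : rel sint := fun x y =>
  if x.1 == y.1 then nested x.2 y.2 ||
    apart x.2 y.2 && ~~ (x.1 && ((x.2.1 == 1) && (y.2.2 == n.+1)
                              || (y.2.1 == 1) && (x.2.2 == n.+1)))
  else disjoint_itv x.2 y.2.

Lemma ndp_dpath N n : n < N ->
  spoly N (ndp_rel n) (ndp_itv n) = spoly N dpath_rel (within 1 n.+1).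
Proof.
move=> nN.
rewrite (@spoly_incompatible _ _ (ndp_itv n)
  (fun x => [&& x.1, ndp_itv n x & x.2.2 == n.+1])
  (fun x => [&& x.1, ndp_itv n x & x.2.1 == 1])); first last.
- by move=> [[] [a b]] [[] [c d]]; rewrite /ndp_itv /ndp_rel; sint_lia.
- by move=> [[] [a b]] /and3P[].
- by move=> [[] [a b]] /and3P[].
rewrite (@spoly_incompatible _ _ (within 1 n.+1)
  (fun x => [&& ~~ x.1, within 1 n.+1 x & x.2.1 == 1])
  (fun x => [&& x.1, within 1 n.+1 x & x.2.1 == 1])); first last.
- by move=> [[] [a b]] [[] [c d]]; sint_lia.
- by move=> [[] [a b]] /and3P[].
- by move=> [[] [a b]] /and3P[].
congr (_ + _ - _)%R.
- apply: eq_spoly => [[[] [a b]]|[[] [a b]] [[] [c d]]]; rewrite /ndp_itv /ndp_rel; sint_lia.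
(* Without the vertex [1] the first path occupies [2, ..., n.+1]; the reflection carries it to
   [1, ..., n] and reverses the second path in place, so antipodal positions still face each other.
   The signs swap because the longer path must become the negative one. *)
- apply: (@spoly_iso _ _ _ _ _ (fun x => (~~ x.1, (n.+2 - x.2.2, n.+2 - x.2.1)))
    (fun x => (~~ x.1, (n.+2 - x.2.2, n.+2 - x.2.1)))).
  + by move=> [] a b; rewrite /ndp_itv; sint_lia.
  + by move=> [] a b; rewrite /ndp_itv; sint_lia.
  + move=> [[] [a b]]; rewrite /ndp_itv; sint_lia => H; (split; first by lia);
      by congr (_, (_, _)); lia.
  + move=> [[] [a b]]; rewrite /ndp_itv; sint_lia => H; (split; first by lia);
      by congr (_, (_, _)); lia.
  + by move=> [[] [a b]] [[] [c d]]; rewrite /ndp_itv /ndp_rel; sint_lia.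
- apply: eq_spoly => [[[] [a b]]|[[] [a b]] [[] [c d]]]; rewrite /ndp_itv /ndp_rel; sint_lia.
Qed.

(** * Tubes of the cycle *)

Section Connectedness.
Variables (T : finType) (e : rel T).
Implicit Types A B : {set T}.

(** Follow a path inside [A] starting at [x]. This serves to confine a tube to one side of a vertex
    that it misses. *)
Lemma induces_connected_sub A B x : induces_connected e A -> x \in A -> x \in B ->
  (forall u v, u \in A -> v \in A -> u \in B -> e u v -> v \in B) -> A \subset B.
Proof.
move=> /forall_inP cA xA xB cB; apply/subsetP => y yA.
have /forall_inP/(_ y yA)/connectP[p ep ->] := cA x xA.
elim: p x xB {xA} ep => //= z p IH x xB /andP[/and3P[xA zA exz]].
by apply: IH; apply: cB exz.
Qed.

Lemma induces_connected_path A (g : nat -> T) a b : symmetric e ->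
  (forall i, a <= i < b -> e (g i) (g i.+1)) ->
  (forall x, x \in A <-> exists2 i, a <= i <= b & x = g i) ->
  induces_connected e A.
Proof.
move=> eC eg gA.
pose R := [rel u v | [&& u \in A, v \in A & e u v]].
have RC : connect_sym R.
  by apply: sym_connect_sym => u v /=; rewrite eC andbCA.
have up i k : a <= i -> i + k <= b -> connect R (g i) (g (i + k)).
  move=> ai; elim: k => [|k IH] kb; first by rewrite addn0.
  apply: connect_trans (IH _) _; first by lia.
  apply: connect1; rewrite addnS /= eg ?andbT; last by lia.
  by apply/andP; split; apply/gA; [exists (i + k)|exists (i + k).+1] => //; lia.
apply/forall_inP => x /gA[i hi ->]; apply/forall_inP => y /gA[j hj ->].
case: (leqP i j) => ij.
  by rewrite -(subnKC ij); apply: up; lia.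
by rewrite RC -(subnKC (ltnW ij)); apply: up; lia.
Qed.

End Connectedness.

Section CycleTubes.
Variable n : nat.
Implicit Types (i j : 'I_n.+1) (A B : {set 'I_n.+1}).

(* A negative interval stands for its complement, which contains [0]. *)
Definition cycle_arc (x : sint) : {set 'I_n.+1} :=
  [set i : 'I_n.+1 | (x.2.1 <= i <= x.2.2) == x.1].

Lemma cycle_adjE i j : cycle_adj i j =
  [|| j == i.+1 :> nat, i == j.+1 :> nat,
      (i == n :> nat) && (j == 0 :> nat) | (j == n :> nat) && (i == 0 :> nat)].
Proof.
have E (k l : 'I_n.+1) : (l == ordS k) = (l == k.+1 :> nat) || ((k == n :> nat) && (l == 0 :> nat)).
  rewrite -val_eqE /=; case: (ltngtP k n) => [kn|kn|kn].
  - by rewrite modn_small //= orbF.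
  - by have := ltn_ord k; lia.
  - by rewrite kn modnn /=; have := ltn_ord l; lia.
by rewrite /cycle_adj !E; lia.
Qed.

Lemma cycle_adjC : symmetric (@cycle_adj n).
Proof. by move=> i j; rewrite /cycle_adj orbC. Qed.

Lemma cycle_arcN s I : cycle_arc (~~ s, I) = ~: cycle_arc (s, I).
Proof. by apply/setP => i; rewrite !inE /=; case: s; case: (_ && _). Qed.

Lemma cycle_arc_sub x y : within 1 n.+1 x -> within 1 n.+1 y ->
  (cycle_arc x \subset cycle_arc y) =
  match x.1, y.1 with
  | true, true => (y.2.1 <= x.2.1) && (x.2.2 <= y.2.2)
  | true, false => disjoint_itv x.2 y.2
  | false, true => false
  | false, false => (x.2.1 <= y.2.1) && (y.2.2 <= x.2.2)
  end.
Proof.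
move: x y => [s [a b]] [t [c d]]; rewrite /within /= => /and3P[a1 ab bn] /and3P[c1 cd dn].
apply/subsetP/idP => [H|H i].
  have Hi k : k < n.+1 -> ((a <= k <= b) == s) -> ((c <= k <= d) == t).
    by move=> kn; have := H (Ordinal kn); rewrite !inE.
  (* The endpoints, their neighbours and [0] are enough test vertices to decide the inclusion. *)
  have := Hi 0 isT; have := Hi a; have := Hi b; have := Hi c; have := Hi d.
  have := Hi a.-1; have := Hi b.+1; have := Hi c.-1; have := Hi d.+1.
  by case: s {H Hi}; case: t; rewrite /disjoint_itv /=; lia.
rewrite !inE /=; move: H; rewrite /disjoint_itv /=.
by case: s; case: t => //=; lia.
Qed.

Lemma cycle_arc_separated x y : within 1 n.+1 x -> within 1 n.+1 y ->
  [disjoint cycle_arc x & cycle_arc y] &&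
    [forall i in cycle_arc x, forall j in cycle_arc y, ~~ cycle_adj i j] =
  match x.1, y.1 with
  | true, true => apart x.2 y.2
  | true, false => inside x.2 y.2
  | false, true => inside y.2 x.2
  | false, false => false
  end.
Proof.
move: x y => [s [a b]] [t [c d]] wx wy.
(* Disjointness is inclusion in the complement, which is the arc of opposite sign. *)
rewrite disjoints_subset -cycle_arcN cycle_arc_sub //=.
move: wx wy; rewrite /within /= => /and3P[a1 ab bn] /and3P[c1 cd dn].
apply/andP/idP => [[H1 /forall_inP H2]|H].
  have Hij (i j : nat) (hi : i < n.+1) (hj : j < n.+1) : ((a <= i <= b) == s) ->
      ((c <= j <= d) == t) -> ~~ cycle_adj (Ordinal hi) (Ordinal hj).
    move=> pi pj; have := H2 (Ordinal hi); rewrite inE => /(_ pi)/forall_inP.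
    by move=> /(_ (Ordinal hj)); rewrite inE; apply.
  move: H1 Hij {H2}; rewrite /disjoint_itv /apart /inside /=.
  case: s; case: t => //= H1 Hij.
  - apply/negPn/negP => H; case/orP: H1 => h.
      by have := @Hij b c bn ltac:(lia) ltac:(lia) ltac:(lia); rewrite cycle_adjE /=; lia.
    by have := @Hij a d ltac:(lia) dn ltac:(lia) ltac:(lia); rewrite cycle_adjE /=; lia.
  (* An interval that reaches an end of the gap left by the other arc is adjacent to that arc; past
     the vertex [n] the neighbour is [0]. *)
  - apply/negPn/negP => H.
    have [h|h] : c = a \/ d = b by lia.
      by have := @Hij a a.-1 ltac:(lia) ltac:(lia) ltac:(lia) ltac:(lia);
        rewrite cycle_adjE /=; lia.
    case: (ltngtP b n) => bn'.
    + by have := @Hij b b.+1 ltac:(lia) ltac:(lia) ltac:(lia) ltac:(lia);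
        rewrite cycle_adjE /=; lia.
    + lia.
    + by have := @Hij b 0 ltac:(lia) ltac:(lia) ltac:(lia) ltac:(lia);
        rewrite cycle_adjE /=; lia.
  - apply/negPn/negP => H.
    have [h|h] : c = a \/ d = b by lia.
      by have := @Hij a.-1 a ltac:(lia) ltac:(lia) ltac:(lia) ltac:(lia);
        rewrite cycle_adjE /=; lia.
    case: (ltngtP b n) => bn'.
    + by have := @Hij b.+1 b ltac:(lia) ltac:(lia) ltac:(lia) ltac:(lia);
        rewrite cycle_adjE /=; lia.
    + lia.
    + by have := @Hij 0 b ltac:(lia) ltac:(lia) ltac:(lia) ltac:(lia);
        rewrite cycle_adjE /=; lia.
split; first by move: H; rewrite /disjoint_itv /apart /inside; case: s; case: t => //=; lia.
apply/forall_inP => i; rewrite inE /= => hi; apply/forall_inP => j; rewrite inE /= => hj.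
rewrite cycle_adjE; move: H hi hj (ltn_ord i) (ltn_ord j); rewrite /apart /inside.
by case: s; case: t => //=; lia.
Qed.

Lemma compatible_cycle_arc x y : within 1 n.+1 x -> within 1 n.+1 y ->
  compatible (@cycle_adj n) (cycle_arc x) (cycle_arc y) = cycle_rel x y.
Proof.
move=> wx wy; rewrite /compatible cycle_arc_separated // !cycle_arc_sub //.
by move: x y wx wy => [[] [a b]] [[] [c d]]; sint_lia.
Qed.

Lemma cycle_arc_inj : {in within 1 n.+1 &, injective cycle_arc}.
Proof.
move=> x y wx wy E.
have := cycle_arc_sub wx wy; have := cycle_arc_sub wy wx; rewrite E subxx.
move: x y wx wy {E} => [[] [a b]] [[] [c d]] //; sint_lia => wx wy.
  by move=> *; congr (_, (_, _)); lia.
by move=> *; congr (_, (_, _)); lia.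
Qed.

Lemma cycle_tube_arc x : within 1 n.+1 x -> cycle_tube (cycle_arc x).
Proof.
move: x => [s [a b]]; rewrite /within /= => /and3P[a1 ab bn].
have an : a < n.+1 by lia.
apply/and3P; split.
- apply/set0Pn; case: s; [exists (Ordinal an)|exists ord0]; rewrite inE /=; lia.
- apply/eqP/setP => H; case: s H => H.
    by have := H ord0; rewrite !inE /=; lia.
  by have := H (Ordinal an); rewrite !inE /=; lia.
pose g k : 'I_n.+1 := inord (k %% n.+1).
have valg k : g k = k %% n.+1 :> nat by rewrite inordK // ltn_pmod.
(* The complement of [[a, b]] is walked from [b.+1] past [n] and [0] up to [a.-1], which is [n + a]
   modulo [n.+1]. *)
apply: (@induces_connected_path _ _ _ g (if s then a else b.+1) (if s then b else n + a)).
- exact: cycle_adjC.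
- move=> i _; apply/orP; left; apply/eqP/val_inj.
  by rewrite /= !valg -addn1 -modnDml addn1.
- move=> i; rewrite inE /=; split.
    case: s => hi.
      by exists i; [lia|apply: val_inj; rewrite /= valg modn_small].
    case: (leqP a i) => ai.
      by exists i; [have := ltn_ord i; lia|apply: val_inj; rewrite /= valg modn_small].
    exists (i + n.+1); first by lia.
    by apply: val_inj; rewrite /= valg modnDr modn_small.
  move=> [k hk ->]; rewrite valg; case: s hk => hk.
    by rewrite modn_small; lia.
  case: (ltnP k n.+1) => kn; first by rewrite modn_small; lia.
  by rewrite -(subnK kn) modnDr modn_small; lia.
Qed.

(** If [0] is missing, [A] cannot wrap around, and a gap [c] would confine it below [c]. If [0] is
    present, a vertex of [A] between two missing ones would confine [A] between them, away from [0];
    so the complement is an interval. *)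
Lemma cycle_tubeP A : cycle_tube A -> exists2 x, within 1 n.+1 x & A = cycle_arc x.
Proof.
move=> /and3P[/set0Pn[x0 x0A] AT cA].
case: (boolP (ord0 \in A)) => A0; last first.
  case: (@arg_minnP _ x0 [in A] val x0A) => a aA mina.
  case: (@arg_maxnP _ x0 [in A] val x0A) => b bA maxb.
  have a0 : 0 < a by rewrite lt0n; apply: contraNneq A0 => E;
    rewrite (_ : ord0 = a) //; apply: val_inj.
  exists (true, (val a, val b)).
    by rewrite /within /= a0 ltn_ord andbT; apply: mina.
  apply/setP => c; rewrite inE /= eqb_id; apply/idP/andP => [cA'|[ac cb]].
    by split; [apply: mina|apply: maxb].
  apply/negPn/negP => cA'.
  have ca : a < c by rewrite ltn_neqAle ac andbT; apply: contraNneq cA' => /val_inj <-.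
  have : A \subset [set i : 'I_n.+1 | i < c].
    apply: (induces_connected_sub cA aA); first by rewrite inE.
    move=> u v uA vA; rewrite !inE cycle_adjE => uc.
    have v0 : v != 0 :> nat by apply: contraNneq A0 => E; rewrite (_ : ord0 = v) //; apply: val_inj.
    have u0 : u != 0 :> nat by apply: contraNneq A0 => E; rewrite (_ : ord0 = u) //; apply: val_inj.
    have vc : v != c :> nat by apply: contraNneq cA' => /val_inj <-.
    lia.
  move=> /subsetP/(_ _ bA); rewrite inE; lia.
have /set0Pn[y0 y0A] : ~: A != set0.
  by apply: contraNneq AT => E; rewrite -(setCK A) E setC0.
case: (@arg_minnP _ y0 [in ~: A] val y0A) => a; rewrite /= inE => aA mina.
case: (@arg_maxnP _ y0 [in ~: A] val y0A) => b; rewrite /= inE => bA maxb.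
have a0 : 0 < a by rewrite lt0n; apply: contraNneq aA => E;
  rewrite (_ : a = ord0) //; apply: val_inj.
exists (false, (val a, val b)).
  by rewrite /within /= a0 ltn_ord andbT; apply: mina; rewrite inE.
apply/setP => c; rewrite inE /= eqbF_neg; apply/idP/idP => [cA'|]; last first.
  apply: contraNT => cA'; apply/andP.
  by split; [apply: mina|apply: maxb]; rewrite inE.
apply/negP => /andP[ac cb].
have ca : a < c by rewrite ltn_neqAle ac andbT; apply: contraNneq aA => /val_inj ->.
have cb' : c < b by rewrite ltn_neqAle cb andbT; apply: contraNneq bA => /val_inj <-.
have : A \subset [set i : 'I_n.+1 | a < i < b].
  apply: (induces_connected_sub cA cA'); first by rewrite inE ca.
  move=> u v uA vA; rewrite !inE cycle_adjE => uc.
  have va : v != a :> nat by apply: contraNneq aA => /val_inj <-.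
  have vb : v != b :> nat by apply: contraNneq bA => /val_inj <-.
  have := ltn_ord b; lia.
by move=> /subsetP/(_ _ A0); rewrite inE /=.
Qed.

Lemma card_cycle_tubing N k : n <= N ->
  Posz #|[set S | @cycle_tubing n S && (#|S| == k)]|
    = ((spoly N cycle_rel (within 1 n.+1))`_k)%R.
Proof.
move=> nN.
rewrite -(@clique_poly_sset N _ cycle_rel (compatible (@cycle_adj n))
           (within 1 n.+1) cycle_arc).
- rewrite coef_clique_poly; congr (Posz #|pred_of_set _|).
  apply/setP => S; rewrite !inE /cycle_tubing -andbA.
  rewrite (_ : [forall A in S, cycle_tube A] = (S \subset [set cycle_arc (unbound x) | x in sset N (within 1 n.+1)])) //.
  apply/forall_inP/subsetP => H A AS.
    have [x wx ->] := cycle_tubeP (H _ AS).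
    apply/imsetP; exists (bound N x).
      by rewrite inE (@boundK N (within 1 n.+1)) //; move=> s a b; rewrite /within /=; lia.
    by rewrite (@boundK N (within 1 n.+1)) //; move=> s a b; rewrite /within /=; lia.
  by have /imsetP[x] := H _ AS; rewrite inE => wx ->; apply: cycle_tube_arc.
- by move=> s a b; rewrite /within /=; lia.
- exact: cycle_arc_inj.
- by move=> x y; apply: compatible_cycle_arc.
Qed.

End CycleTubes.

(** * Tubes of the near double path *)

Lemma consecutiveP (s : seq int) (x y : int) :
  reflect (exists2 i, i.+1 < size s & x = nth 0%R s i /\ y = nth 0%R s i.+1)
          (consecutive s x y).
Proof.
rewrite /consecutive; case: s => [|z s] /=; first by right; case.
elim: s z => [|w s IH] z; first by right; case.
rewrite (_ : zip _ _ = (z, w) :: zip (w :: s) s) // inE; apply: (iffP orP).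
  move=> [/eqP[-> ->]|/(IH w)[i hi [-> ->]]]; first by exists 0.
  by exists i.+1.
move=> [[|i] hi [xE yE]]; first by left; rewrite xE yE.
by right; apply/(IH w); exists i.
Qed.

Lemma size_ndp_path1 n : size (ndp_path1 n) = n.+1.
Proof. by rewrite size_rcons size_map size_iota. Qed.

Lemma size_ndp_path2 n : size (ndp_path2 n) = n.-1.
Proof. by rewrite size_map size_iota. Qed.

Lemma nth_ndp_path1 n i : i <= n ->
  nth 0%R (ndp_path1 n) i = if i == n then (- 1)%R else Posz i.+1.
Proof.
move=> hi; rewrite nth_rcons size_map size_iota.
case: ltngtP hi => // hi _.
by rewrite (nth_map 0) ?size_iota // nth_iota // add1n.
Qed.

Lemma nth_ndp_path2 n i : i < n.-1 -> nth 0%R (ndp_path2 n) i = (- Posz i.+2)%R.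
Proof.
by move=> hi; rewrite (nth_map 0) ?size_iota // nth_iota // add2n.
Qed.

Section NdpTubes.
Variable m : nat.
Let n := m.+1.
Implicit Types (u v : pm n) (A B : {set pm n}).

Definition on_first (u : pm n) : bool := u.2 || (u.1 == 0 :> nat).

Definition position (u : pm n) : nat :=
  if ~~ u.2 && (u.1 == 0 :> nat) then n.+1 else u.1.+1.

Definition vertex (s : bool) (p : nat) : pm n :=
  if p == n.+1 then (ord0, false) else (inord p.-1, s).

Lemma position_bound u : if on_first u then 0 < position u <= n.+1
                         else 1 < position u <= n.
Proof.
move: u => [[i hi] []]; rewrite /on_first /position /=.
  by rewrite /n; lia.
by case: eqP; rewrite /n; lia.
Qed.

Lemma vertexK u : vertex (on_first u) (position u) = u.
Proof.
move: u => [[i hi] []]; rewrite /vertex /on_first /position /=.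
  rewrite (_ : (_ == _) = false); last by rewrite /n; lia.
  by congr pair; apply: val_inj; rewrite /= inordK.
case: (altP (i =P 0)) => i0 /=.
  by rewrite eqxx; congr pair; apply: val_inj.
rewrite (_ : (_ == _) = false); last by rewrite /n; lia.
by congr pair; apply: val_inj; rewrite /= inordK.
Qed.

Lemma position_vertex s p :
  (if s then 0 < p <= n.+1 else 1 < p <= n) ->
  on_first (vertex s p) = s /\ position (vertex s p) = p.
Proof.
move=> h; rewrite /vertex; case: (altP (p =P n.+1)) => pn.
  by case: s h => h; rewrite /on_first /position //=; rewrite /n in h pn *; lia.
have pm' : p.-1 < m.+1 by case: s h; rewrite /n in pn *; lia.
rewrite /on_first /position /= !inordK //.
by case: s h => /= h; [split; lia|case: eqP; lia].
Qed.

Lemma ndp_adjE u v : ndp_adj u v = (on_first u == on_first v) &&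
  ((position u == (position v).+1) || (position v == (position u).+1)).
Proof.
have E1 (x y : pm n) : consecutive (ndp_path1 n) (pm_int x) (pm_int y) =
    [&& on_first x, on_first y & position y == (position x).+1].
  apply/consecutiveP/idP.
    move=> [i]; rewrite size_ndp_path1 => hi []; rewrite !nth_ndp_path1; [|lia|lia].
    rewrite (_ : (i == n) = false); last by lia.
    move: x y => [[k hk] s] [[l hl] t]; rewrite /pm_int /on_first /position /=.
    case: (altP (i.+1 =P n)) => iN; case: (altP (k =P 0)) => k0; case: (altP (l =P 0)) => l0;
      case: s; case: t => /=; rewrite /n in iN hi hk hl *; lia.
  move: x y => [[k hk] s] [[l hl] t] H; exists k.
    by rewrite size_ndp_path1; lia.
  rewrite !nth_ndp_path1 ?(ltnW hk) //.
  rewrite (_ : (k == n) = false); last by lia.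
  move: H; rewrite /on_first /position /pm_int /=.
  case: (altP (k.+1 =P n)) => kN; case: (altP (k =P 0)) => k0; case: (altP (l =P 0)) => l0;
    case: s; case: t => /=; rewrite /n in kN hk hl *; lia.
have E2 (x y : pm n) : consecutive (ndp_path2 n) (pm_int x) (pm_int y) =
    [&& ~~ on_first x, ~~ on_first y & position y == (position x).+1].
  apply/consecutiveP/idP.
    move=> [i]; rewrite size_ndp_path2 => hi []; rewrite !nth_ndp_path2; [|lia|lia].
    move: x y => [[k hk] s] [[l hl] t]; rewrite /pm_int /on_first /position /=.
    case: (altP (k =P 0)) => k0; case: (altP (l =P 0)) => l0;
      case: s; case: t => /=; rewrite /n in hi hk hl *; lia.
  move: x y => [[k hk] s] [[l hl] t]; rewrite /on_first /position /pm_int /= => H.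
  have [-> -> k0 lk] : [/\ s = false, t = false, k != 0 & l = k.+1].
    move: H; case: (altP (k =P 0)) => k0; case: (altP (l =P 0)) => l0;
      case: s; case: t => //=; split=> //; lia.
  have hk1 : k.-1.+1 < n.-1 by rewrite /n in hl *; lia.
  exists k.-1; first by rewrite size_ndp_path2.
  rewrite !nth_ndp_path2 //; last by lia.
  by split; lia.
rewrite /ndp_adj /= !E1 !E2.
by case: (on_first u); case: (on_first v) => //=; rewrite ?orbF orbC.
Qed.

Lemma ndp_adjC : symmetric (@ndp_adj n).
Proof. by move=> u v; rewrite !ndp_adjE eq_sym orbC. Qed.

Lemma position_opp u : (on_first (pm_opp u) != on_first u) && (position (pm_opp u) == position u)
  || (on_first u && on_first (pm_opp u)
      && ((position u == 1) && (position (pm_opp u) == n.+1)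
        || (position u == n.+1) && (position (pm_opp u) == 1))).
Proof.
move: u => [[i hi] []]; rewrite /pm_opp /on_first /position /=; case: (altP (i =P 0)) => i0 /=; rewrite /n in hi *; lia.
Qed.

Definition ndp_segment (x : sint) : {set pm n} :=
  [set u | (on_first u == x.1) && (x.2.1 <= position u <= x.2.2)].

Lemma in_ndp_segment x s p : ndp_itv n x ->
  x.2.1 <= p <= x.2.2 -> x.1 = s ->
  [/\ vertex s p \in ndp_segment x, on_first (vertex s p) = s & position (vertex s p) = p].
Proof.
move=> qx px <-; have [|E1 E2] := @position_vertex x.1 p.
  by move: x qx px => [[] [a b]]; rewrite /ndp_itv /=; lia.
by split=> //; rewrite inE E1 E2 eqxx.
Qed.


Lemma ndp_segment_sub x y : ndp_itv n x -> ndp_itv n y ->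
  (ndp_segment x \subset ndp_segment y)
    = [&& x.1 == y.1, y.2.1 <= x.2.1 & x.2.2 <= y.2.2].
Proof.
move=> qx qy; apply/subsetP/idP => [H|/and3P[/eqP E h1 h2] u]; last first.
  by rewrite !inE E => /andP[-> /=]; lia.
have ab : x.2.1 <= x.2.2 by move: qx; rewrite /ndp_itv; case: ifP => _ /and3P[].
have [ua f1 p1] := in_ndp_segment qx (p := x.2.1) ltac:(lia) erefl.
have [ub f2 p2] := in_ndp_segment qx (p := x.2.2) ltac:(lia) erefl.
have := H _ ua; have := H _ ub; rewrite !inE f1 f2 p1 p2; lia.
Qed.

Lemma ndp_segment_separated x y : ndp_itv n x -> ndp_itv n y ->
  [disjoint ndp_segment x & ndp_segment y] &&
    [forall u in ndp_segment x, forall v in ndp_segment y, ~~ ndp_adj u v]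
  = (x.1 != y.1) || apart x.2 y.2.
Proof.
move=> qx qy; apply/andP/idP => [[H1 /forall_inP H2]|H].
  apply/negPn/negP; rewrite negb_or negbK => /andP[/eqP E nap].
  have x12 : x.2.1 <= x.2.2 by move: qx; rewrite /ndp_itv; case: ifP => _ /and3P[].
  have y12 : y.2.1 <= y.2.2 by move: qy; rewrite /ndp_itv; case: ifP => _ /and3P[].
  have nadj i j : x.2.1 <= i <= x.2.2 -> y.2.1 <= j <= y.2.2 ->
      [/\ i != j, i != j.+1 & j != i.+1].
    move=> hi hj.
    have [ui fi pi] := in_ndp_segment qx hi erefl.
    have [uj fj pj] := in_ndp_segment qy hj erefl.
    have := H2 _ ui => /forall_inP/(_ _ uj); rewrite ndp_adjE fi fj pi pj E eqxx /= negb_or.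
    move=> /andP[-> ->]; split=> //; apply/eqP => ij.
    move/pred0P: H1 => /(_ (vertex x.1 i)) /=; rewrite ui /= => /negP; apply.
    by rewrite ij E.
  have [h|h] := leqP x.2.1 y.2.1.
    (* As the segments are not apart, this position of [x] is [y.2.1] or its predecessor, so two
       vertices coincide or are adjacent. *)
    have [] := nadj (minn x.2.2 y.2.1) y.2.1; first by lia.
      by lia.
    by move: nap; rewrite /apart; lia.
  have [] := nadj x.2.1 (minn y.2.2 x.2.1); first by lia.
    by lia.
  by move: nap; rewrite /apart; lia.
split.
  apply/pred0P => u /=; rewrite !inE; apply/negP => /andP[/andP[/eqP E1 h1] /andP[/eqP E2 h2]].
  by move: H; rewrite -E1 -E2 eqxx /apart; lia.
apply/forall_inP => u; rewrite inE => /andP[/eqP E1 h1].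
apply/forall_inP => v; rewrite inE => /andP[/eqP E2 h2].
rewrite ndp_adjE E1 E2; move: H; rewrite /apart; case: (_ == _) => //=; lia.
Qed.

Lemma no_antipodalP A : reflect (forall u, u \in A -> pm_opp u \in A -> False) (no_antipodal A).
Proof.
apply: (iffP forallP) => [H u uA oA|H u]; first by have := H u; rewrite uA oA.
by apply/negP => /andP[]; apply: H.
Qed.

Lemma pm_opp_vertex1 : pm_opp (vertex true 1) = vertex true n.+1.
Proof.
by rewrite /pm_opp /vertex eqxx /=; congr pair; apply: val_inj; rewrite /= inordK.
Qed.

Lemma pm_opp_vertex p s : 1 < p <= n -> pm_opp (vertex s p) = vertex (~~ s) p.
Proof. by move=> hp; rewrite /pm_opp /vertex (_ : (p == _) = false) //; lia. Qed.

Lemma no_antipodal_segmentU x y : ndp_itv n x -> ndp_itv n y ->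
  no_antipodal (ndp_segment x :|: ndp_segment y) =
  if x.1 == y.1 then ~~ (x.1 && ((x.2.1 == 1) && (y.2.2 == n.+1)
                              || (y.2.1 == 1) && (x.2.2 == n.+1)))
  else disjoint_itv x.2 y.2.
Proof.
move=> qx qy; apply/no_antipodalP/idP => [H|H u]; last first.
  have := position_opp u; have := position_bound u; have := position_bound (pm_opp u).
  move: qx qy H; rewrite !inE /ndp_itv /disjoint_itv.
  by move: x y => [[] [a b]] [[] [c d]] /=;
    case: (on_first u); case: (on_first (pm_opp u)) => //=; lia.
have x12 : x.2.1 <= x.2.2 by move: qx; rewrite /ndp_itv; case: ifP => _ /and3P[].
have y12 : y.2.1 <= y.2.2 by move: qy; rewrite /ndp_itv; case: ifP => _ /and3P[].
case: eqP => E.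
  apply/negP => /andP[x1 /orP[]/andP[/eqP h1 /eqP h2]].
    have [ua fa pa] := in_ndp_segment qx (p := 1) ltac:(lia) x1.
    have [ub fb pb] := in_ndp_segment qy (p := n.+1) ltac:(lia) (etrans (esym E) x1).
    by apply: (H (vertex true 1)); rewrite ?pm_opp_vertex1 inE ?ua ?ub ?orbT.
  have [ua fa pa] := in_ndp_segment qy (p := 1) ltac:(lia) (etrans (esym E) x1).
  have [ub fb pb] := in_ndp_segment qx (p := n.+1) ltac:(lia) x1.
  by apply: (H (vertex true 1)); rewrite ?pm_opp_vertex1 inE ?ua ?ub ?orbT.
(* Overlapping intervals share the larger left end. A position occurring on both paths lies in
   [2, ..., n], where opposite vertices sit at the same position. *)
apply/negPn/negP => nd; pose p := maxn x.2.1 y.2.1.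
have hx : x.2.1 <= p <= x.2.2 by move: nd; rewrite /disjoint_itv /p; lia.
have hy : y.2.1 <= p <= y.2.2 by move: nd; rewrite /disjoint_itv /p; lia.
have [ua _ _] := in_ndp_segment qx hx erefl.
have [ub _ _] := in_ndp_segment qy hy erefl.
apply: (H (vertex x.1 p)); first by rewrite inE ua.
rewrite pm_opp_vertex; last first.
  by move: E qx qy hx hy; rewrite /ndp_itv; case: (x.1); case: (y.1) => //=; lia.
have -> : ~~ x.1 = y.1 by move: E; case: (x.1); case: (y.1).
by rewrite inE ub orbT.
Qed.

Definition weakly_compatible : rel {set pm n} := fun A B =>
  compatible (@ndp_adj n) A B && no_antipodal (A :|: B).

Lemma weakly_compatible_segment x y : ndp_itv n x -> ndp_itv n y ->
  weakly_compatible (ndp_segment x) (ndp_segment y) = ndp_rel n x y.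
Proof.
move=> qx qy; rewrite /weakly_compatible /compatible no_antipodal_segmentU //.
rewrite ndp_segment_separated // !ndp_segment_sub // /ndp_rel.
move: x y qx qy => [[] [a b]] [[] [c d]]; rewrite /ndp_itv /nested /apart /disjoint_itv /=; lia.
Qed.

Lemma ndp_segment_inj : {in ndp_itv n &, injective ndp_segment}.
Proof.
move=> x y qx qy E.
have := ndp_segment_sub qx qy; have := ndp_segment_sub qy qx; rewrite E subxx.
move: x y {qx qy E} => [s [a b]] [t [c d]] /= /esym/and3P[/eqP -> h1 h2] /esym/and3P[_ h3 h4].
by congr (_, (_, _)); lia.
Qed.

Lemma ndp_tube_segment x : ndp_itv n x -> ndp_tube (ndp_segment x).
Proof.
move=> qx; apply/and3P; split.
- have ab : x.2.1 <= x.2.2 by move: qx; rewrite /ndp_itv; case: ifP => _ /and3P[].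
  have [ua _ _] := in_ndp_segment qx (p := x.2.1) ltac:(lia) erefl.
  by apply/set0Pn; exists (vertex x.1 x.2.1).
- apply: (@induces_connected_path _ _ _ (vertex x.1) x.2.1 x.2.2).
  + exact: ndp_adjC.
  + move=> i hi.
    have [_ f1 p1] := in_ndp_segment qx (p := i) ltac:(lia) erefl.
    have [_ f2 p2] := in_ndp_segment qx (p := i.+1) ltac:(lia) erefl.
    by rewrite ndp_adjE f1 f2 p1 p2 !eqxx orbT.
  + move=> u; split=> [|[i hi ->]]; last by have [] := in_ndp_segment qx hi erefl.
    rewrite inE => /andP[/eqP <- h]; exists (position u) => //; by rewrite vertexK.
- rewrite -[ndp_segment x]setUid no_antipodal_segmentU // eqxx.
  move: x qx => [[] [a b]]; rewrite /ndp_itv //=; lia.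
Qed.

(** Edges never change path, so [A] lies on one path, and a gap would confine it below the gap. The
    full first path is excluded because it contains both [1] and [-1]. *)
Lemma ndp_tubeP A : ndp_tube A -> exists2 x, ndp_itv n x & A = ndp_segment x.
Proof.
move=> /and3P[/set0Pn[u0 u0A] cA /no_antipodalP nA].
have fA : A \subset [set u | on_first u == on_first u0].
  apply: (induces_connected_sub cA u0A); first by rewrite inE.
  by move=> u v _ _; rewrite !inE ndp_adjE => /eqP -> /andP[/eqP ->].
case: (@arg_minnP _ u0 [in A] (@position) u0A) => a aA mina.
case: (@arg_maxnP _ u0 [in A] (@position) u0A) => b bA maxb.
have := subsetP fA _ aA; have := subsetP fA _ bA; rewrite !inE => /eqP fb /eqP fa.
exists (on_first u0, (position a, position b)).
  have := position_bound a; have := position_bound b; have := mina _ bA.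
  rewrite /ndp_itv fa fb /=; case E: (on_first u0); last by lia.
  move=> h1 h2 h3; apply/and4P; split; [lia|lia|lia|].
  apply/negPn/negP => h; apply: (nA a aA).
  rewrite -(vertexK a) fa E (_ : position a = 1) ?pm_opp_vertex1; last by lia.
  by rewrite (_ : n.+1 = position b) -?E -?fb ?vertexK //; lia.
apply/setP => c; rewrite inE /=; apply/idP/andP => [cA'|[/eqP fc /andP[ac cb]]].
  have := subsetP fA _ cA'; rewrite inE => ->; split=> //.
  by apply/andP; split; [apply: mina|apply: maxb].
apply/negPn/negP => cA'.
have pc u : u \in A -> position u != position c.
  move=> uA; apply: contraNneq cA' => E; rewrite -(vertexK c) fc -E.
  by have := subsetP fA _ uA; rewrite inE => /eqP <-; rewrite vertexK.
have : A \subset [set u | position u < position c].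
  apply: (induces_connected_sub cA aA); first by rewrite inE ltn_neqAle ac pc.
  move=> u v uA vA; rewrite !inE ndp_adjE; move: (pc _ uA) (pc _ vA).
  move: (position u) (position v) (position c) (_ == _ :> bool) => pu pv pw sgn; clear; lia.
by move=> /subsetP/(_ _ bA); rewrite inE ltnNge cb.
Qed.

(** An antipodal pair in the union is already found in the union of at most two tubes, so the global
    condition on a tubing is a pairwise one. *)
Lemma ndp_tubingE (S : {set {set pm n}}) :
  ndp_tubing S = [forall A in S, ndp_tube A] && clique weakly_compatible S.
Proof.
rewrite /ndp_tubing; congr andb; apply/andP/cliqueP.
  move=> [/cliqueP cS /no_antipodalP nS] A B AS BS; rewrite /weakly_compatible cS //=.
  apply/no_antipodalP => u uAB oAB; apply: (nS u); apply/bigcupP.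
    by move: uAB; rewrite inE => /orP[]; [exists A|exists B].
  by move: oAB; rewrite inE => /orP[]; [exists A|exists B].
move=> H; split.
  by apply/cliqueP => A B AS BS; have /andP[] := H _ _ AS BS.
apply/no_antipodalP => u /bigcupP[A AS uA] /bigcupP[B BS uB].
have /andP[_ /no_antipodalP/(_ u)] := H _ _ AS BS.
by rewrite !inE uA uB orbT; apply.
Qed.

Lemma card_ndp_tubing N k : n < N ->
  Posz #|[set S | @ndp_tubing n S && (#|S| == k)]|
    = ((spoly N (ndp_rel n) (ndp_itv n))`_k)%R.
Proof.
move=> nN.
have bq : bounded N (ndp_itv n) by move=> [] a b; rewrite /ndp_itv /=; lia.
rewrite -(@clique_poly_sset N _ _ weakly_compatible (ndp_itv n) ndp_segment) //.
- rewrite coef_clique_poly; congr (Posz #|pred_of_set _|).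
  apply/setP => S; rewrite !inE ndp_tubingE -andbA.
  rewrite (_ : [forall A in S, ndp_tube A]
    = (S \subset [set ndp_segment (unbound x) | x in sset N (ndp_itv n)])) //.
  apply/forall_inP/subsetP => H A AS.
    have [x qx ->] := ndp_tubeP (H _ AS).
    by apply/imsetP; exists (bound N x); rewrite ?inE (boundK bq).
  by have /imsetP[x] := H _ AS; rewrite inE => qx ->; apply: ndp_tube_segment.
- exact: ndp_segment_inj.
- by move=> x y; apply: weakly_compatible_segment.
Qed.

End NdpTubes.

Theorem card_tubings n k : 0 < n ->
  #|[set S | @ndp_tubing n S && (#|S| == k)]| = #|[set S | @cycle_tubing n S && (#|S| == k)]|.
Proof.
case: n => // n _; apply/eqP; rewrite -eqz_nat; apply/eqP.
rewrite (@card_ndp_tubing _ n.+2) // (@card_cycle_tubing _ n.+2) //.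
by rewrite ndp_dpath // cycle_dpath.
Qed.

(** * Cones of valid functionals *)

Local Open Scope ring_scope.

Lemma row_free_rowsub1 (F : fieldType) (k n : nat) (f : 'I_k -> 'I_n) :
  injective f -> row_free (rowsub f (1%:M : 'M[F]_n)).
Proof.
move=> injf; apply/row_freeP; exists (rowsub f 1%:M)^T.
by apply/matrixP => i j; rewrite mul_rowsub_mx mul1mx !mxE (inj_eq injf) eq_sym.
Qed.

Lemma row_free_rowsub (F : fieldType) (k m n : nat) (f : 'I_k -> 'I_m) (A : 'M[F]_(m, n)) :
  injective f -> row_free A -> row_free (rowsub f A).
Proof.
move=> injf fA; rewrite -[A]mul1mx -mul_rowsub_mx /row_free mxrankMfree //.
exact: row_free_rowsub1.
Qed.

Lemma mxrank_rowsub1 (F : fieldType) (n : nat) (J : {set 'I_n}) :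
  \rank (rowsub (fun i : 'I_#|J| => enum_val i) (1%:M : 'M[F]_n)) = #|J|.
Proof. by apply/eqP; apply: row_free_rowsub1; apply: enum_val_inj. Qed.

Lemma sub_rowsub1P (F : fieldType) (n : nat) (J : {set 'I_n}) (u : 'rV[F]_n) :
  reflect (forall j, j \notin J -> u 0 j = 0)
    (u <= rowsub (fun i : 'I_#|J| => enum_val i) (1%:M : 'M[F]_n))%MS.
Proof.
apply: (iffP submxP) => [[D ->] j jJ|H].
  rewrite mxE big1 // => i _; rewrite !mxE.
  case: eqP => [E|]; last by rewrite mulr0.
  by move: jJ; rewrite -E enum_valP.
exists (\row_i u 0 (enum_val i)); apply/rowP => j; rewrite mxE.
have [jJ|jJ] := boolP (j \in J); last first.
  rewrite H // big1 // => i _; rewrite !mxE.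
  case: eqP => [E|]; last by rewrite mulr0.
  by move: jJ; rewrite -E enum_valP.
rewrite (bigD1 (enum_rank_in jJ j)) //= !mxE enum_rankK_in // eqxx mulr1.
rewrite big1 ?addr0 // => i ne; rewrite !mxE; case: eqP => [E|]; last by rewrite mulr0.
by case/eqP: ne; apply: enum_val_inj; rewrite enum_rankK_in.
Qed.

Section TightRows.
Variables (R : realFieldType) (m d : nat) (W : 'M[R]_(m, d)).
Implicit Types (c g : 'cV[R]_d).

Definition tight c (i : 'I_m) : bool := (W *m c) i 0 == 0.

(** Slack rows are zeroed rather than deleted, which keeps the index type ['I_m]; for the rays at a
    point of a polytope the rank of this matrix is the dimension of the face exposed by [c]. *)
Definition tight_rows c : 'M[R]_(m, d) := \matrix_i (if tight c i then row i W else 0).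

Definition valid_at c : Prop := forall i, (W *m c) i 0 <= 0.

Lemma row_tight c i : tight c i -> row i (tight_rows c) = row i W.
Proof. by move=> ti; rewrite rowK ti. Qed.

Lemma mulmx_row_entry k (A : 'M[R]_(k, d)) c i : (row i A *m c) 0 0 = (A *m c) i 0.
Proof. by rewrite -row_mul mxE. Qed.

Lemma tight_rowsP p c (g : 'M[R]_(d, p)) :
  tight_rows c *m g = 0 <-> forall i, tight c i -> row i W *m g = 0.
Proof.
split=> [H i ti|H].
  by rewrite -(row_tight ti) -row_mul H row0.
apply/row_matrixP => i; rewrite row_mul rowK row0.
by case: ifP => [/H //|_]; rewrite mul0mx.
Qed.

Lemma tight_rows_sub c : (tight_rows c <= W)%MS.
Proof. by apply/row_subP => i; rewrite rowK; case: ifP => _; rewrite ?row_sub ?sub0mx. Qed.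

Lemma tight_rows_mul c : tight_rows c *m c = 0.
Proof.
apply/tight_rowsP => i /eqP ti; apply/rowP => j; by rewrite ord1 mulmx_row_entry ti mxE.
Qed.

Lemma mxrank_ltn_witness p q (A : 'M[R]_(p, d)) (B : 'M[R]_(q, d)) :
  (\rank A < \rank B)%N -> exists2 g : 'cV[R]_d, A *m g = 0 & B *m g != 0.
Proof.
move=> lt; have : ~~ (B <= A)%MS by apply: contraTN lt => /mxrankS; rewrite -leqNgt.
rewrite submxE => nz.
have /existsP[j nzj] : [exists j, col j (B *m cokermx A) != 0].
  apply: contraNT nz; rewrite negb_exists => /forallP E; apply/eqP/matrixP => i j.
  by have := E j; rewrite negbK => /eqP/colP/(_ i); rewrite !mxE.
exists (col j (cokermx A)); last by rewrite colE mulmxA -colE.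
by rewrite colE mulmxA mulmx_coker mul0mx.
Qed.

(* Move from [c] along [g] until another row becomes tight. *)
Lemma ratio_test c g : valid_at c -> tight_rows c *m g = 0 ->
  (exists i, 0 < (W *m g) i 0) ->
  exists2 t : R, 0 < t &
    valid_at (c + t *: g) /\ (\rank (tight_rows c) < \rank (tight_rows (c + t *: g)))%N.
Proof.
move=> vc tg [i0 gi0].
have slack i : 0 < (W *m g) i 0 -> (W *m c) i 0 < 0.
  move=> gi; rewrite lt_neqAle vc andbT; apply: contraTneq gi => /eqP ti.
  have /tight_rowsP/(_ i ti) E := tg.
  by rewrite -mulmx_row_entry E mxE ltxx.
pose rho i := - (W *m c) i 0 / (W *m g) i 0.
have [i gi mini] := @Order.TotalTheory.arg_minP _ _ _ i0 (fun i => 0 < (W *m g) i 0) rho gi0.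
have ent k : (W *m (c + rho i *: g)) k 0 = (W *m c) k 0 + rho i * (W *m g) k 0.
  by rewrite mulmxDr -scalemxAr !mxE.
have rho0 : 0 < rho i by rewrite divr_gt0 // oppr_gt0 slack.
exists (rho i) => //; split.
  move=> k; rewrite ent; have [gk|gk] := ltP 0 ((W *m g) k 0).
    by have := mini k gk; rewrite {2}/rho ler_pdivlMr //; lra.
  have := vc k; have := mulr_ge0_le0 (ltW rho0) gk; lra.
have ti : tight (c + rho i *: g) i.
  by rewrite /tight ent /rho divfK ?subrr // gt_eqF.
have sub : (tight_rows c <= tight_rows (c + rho i *: g))%MS.
  apply/row_subP => k; rewrite rowK; case: ifP => tk; last by rewrite sub0mx.
  rewrite -(@row_tight (c + rho i *: g)) ?row_sub // /tight ent.
  have /tight_rowsP/(_ k tk) E := tg.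
  have -> : (W *m g) k 0 = 0 by rewrite -mulmx_row_entry E mxE.
  by rewrite mulr0 addr0.
(* [g] kills the old tight rows but not row [i], so the newly tight row [i] lies outside their
   span. *)
rewrite ltn_neqAle mxrankS // andbT; apply/eqP => E.
have sup : (tight_rows (c + rho i *: g) <= tight_rows c)%MS.
  by rewrite -(mxrank_leqif_sup sub) E.
have : (row i W <= tight_rows c)%MS.
  by apply: submx_trans sup; rewrite -(row_tight ti) row_sub.
move=> /submxP[D E']; move: gi; rewrite -mulmx_row_entry E' -mulmxA tg mulmx0 mxE.
by rewrite ltxx.
Qed.

(* A functional of corank at least two is a convex combination of two valid ones
   with more tight rows: move both ways along some [g] that kills the tight rows
   and the sum of all rows. *)
Lemma valid_cone_ind (Q : 'cV[R]_d -> Prop) :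
  (forall c, W *m c = 0 -> Q c) ->
  (forall c, valid_at c -> (\rank (tight_rows c)).+1 = \rank W -> Q c) ->
  (forall c c' a a', 0 <= a -> 0 <= a' -> Q c -> Q c' -> Q (a *: c + a' *: c')) ->
  forall c, valid_at c -> Q c.
Proof.
move=> Q0 Q1 Q2 c.
have [k] := ubnP (\rank W - \rank (tight_rows c)).
elim: k c => // k IH c lek vc.
have := mxrankS (tight_rows_sub c); rewrite leq_eqVlt => /orP[/eqP E|].
  apply: Q0; have : (W <= tight_rows c)%MS.
    by rewrite -(mxrank_leqif_sup (tight_rows_sub c)) E.
  by move=> /submxP[D E']; rewrite E' -mulmxA tight_rows_mul mulmx0.
rewrite leq_eqVlt => /orP[/eqP E|lt2]; first exact: Q1.
(* Corank at least two leaves room for the extra condition [p *m g = 0]. The entries of [W *m g]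
   then sum to zero without all vanishing, so [g] and [- g] each have a positive entry, as
   [ratio_test] needs. *)
pose p : 'rV[R]_d := const_mx 1 *m W.
have [|g] := @mxrank_ltn_witness _ _ (col_mx (tight_rows c) p) W.
  rewrite -addsmxE; apply: leq_ltn_trans (mxrank_adds_leqif _ _) _.
  by have := rank_leq_row p; lia.
rewrite mul_col_mx => /eqP; rewrite col_mx_eq0 => /andP[/eqP tg /eqP pg] Wg.
have sum0 : \sum_i (W *m g) i 0 = 0.
  move/rowP: pg => /(_ 0); rewrite -mulmxA !mxE => pg; rewrite -[RHS]pg.
  by apply: eq_bigr => i _; rewrite !mxE mul1r.
have pos (h : 'cV[R]_d) : W *m h != 0 -> \sum_i (W *m h) i 0 = 0 ->
    exists i, 0 < (W *m h) i 0.
  move=> Wh sh; apply/existsP; apply: contraNT Wh; rewrite negb_exists => /forallP np.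
  have le0 i : 0 <= - (W *m h) i 0 by rewrite oppr_ge0 leNgt.
  apply/eqP/colP => i; rewrite [RHS]mxE; apply/eqP; rewrite -oppr_eq0.
  have s0 : \sum_i - (W *m h) i 0 = 0 by rewrite sumrN sh oppr0.
  by rewrite (psumr_eq0P (fun i _ => le0 i) s0 (i := i)).
have [t t0 [v1 r1]] := ratio_test vc tg (pos _ Wg sum0).
have [||i hi] := pos (- g).
- by rewrite mulmxN oppr_eq0.
- by under eq_bigr do rewrite mulmxN mxE; rewrite sumrN sum0 oppr0.
have tgN : tight_rows c *m (- g) = 0 by rewrite mulmxN tg oppr0.
have [t' t'0 [v2 r2]] := ratio_test vc tgN (ex_intro _ i hi).
have tt : 0 < t + t' by apply: addr_gt0.
have -> : c = (t' / (t + t')) *: (c + t *: g) + (t / (t + t')) *: (c + t' *: - g).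
  apply/colP => j; rewrite !mxE; field; by rewrite gt_eqF.
have ineq x : (\rank (tight_rows c) < x)%N -> (\rank W - x < k)%N by lia.
by apply: Q2; [apply: divr_ge0; lra|apply: divr_ge0; lra|apply: IH => //; exact: ineq..].
Qed.

End TightRows.

Lemma small_perturbation (R : realFieldType) (I : finType) (a b : I -> R) :
  exists2 eps : R, 0 < eps & forall i, a i < 0 -> a i + eps * b i < 0.
Proof.
(* [s] dominates every ratio [|b i| / - a i] with [a i < 0], so the step [1 / (1 + s)] is short
   enough for all [i] at once. *)
pose s := \sum_(i | a i < 0) `|b i| / - a i.
have s0 : 0 <= s by apply: sumr_ge0 => i ai; rewrite divr_ge0 // oppr_ge0 ltW.
exists (1 + s)^-1; first by rewrite invr_gt0; lra.
move=> i ai; rewrite -(pmulr_rlt0 _ (_ : 0 < 1 + s)); last by lra.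
rewrite mulrDr mulVKf; last by rewrite gt_eqF //; lra.
have le : `|b i| / - a i <= s.
  rewrite /s (bigD1 i) //= lerDl; apply: sumr_ge0 => j /andP[aj _].
  by rewrite divr_ge0 // oppr_ge0 ltW.
have : `|b i| <= s * - a i by rewrite -ler_pdivrMr // oppr_gt0.
have := ler_norm (b i); nra.
Qed.

(** * The facet functionals at a simple vertex *)

Section SimpleVertex.
Variables (R : realFieldType) (m d n : nat) (W : 'M[R]_(m, d)) (C : 'M[R]_(d, n)).
Hypothesis rankW : \rank W = n.
Hypothesis validC : forall j, valid_at W (col j C).
Hypothesis allC : forall c, valid_at W c -> (\rank (tight_rows W c)).+1 = n ->
  exists j, tight W c =1 tight W (col j C).
Hypothesis exposed : exists c : 'cV[R]_d, forall i, row i W != 0 -> (W *m c) i 0 < 0.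

(** Functionals are compared through their values on the rays, since the ambient dimension [d] may
    exceed [n] and functionals vanishing on all rays cannot be told apart. *)
Let K := W *m C.

Lemma K_le0 i j : K i j <= 0.
Proof. by have := validC j i; rewrite colE mulmxA -colE mxE. Qed.

Lemma eq_tight_rows c c' : tight W c =1 tight W c' -> tight_rows W c = tight_rows W c'.
Proof. by move=> E; apply/row_matrixP => i; rewrite !rowK E. Qed.

(* A functional on an [n]-dimensional space is determined up to a factor by a
   hyperplane on which it vanishes. *)
Lemma corank1_proportional c c' : valid_at W c -> valid_at W c' ->
  (\rank (tight_rows W c)).+1 = n -> tight W c =1 tight W c' ->
  exists2 a, 0 <= a & W *m c = a *: (W *m c').
Proof.
move=> vc vc' rc tE.
have nsub : ~~ (W <= tight_rows W c)%MS.
  by apply/negP => /mxrankS; rewrite rankW; lia.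
have /row_subPn[i ni] := nsub.
have nt : ~~ tight W c i by apply: contra ni => ti; rewrite -(row_tight ti) row_sub.
have neg : (W *m c) i 0 < 0 by rewrite lt_neqAle vc andbT.
have neg' : (W *m c') i 0 < 0 by rewrite lt_neqAle vc' andbT -/(tight W c' i) -tE.
pose a := (W *m c) i 0 / (W *m c') i 0.
exists a; first by rewrite /a -mulrNN -invrN divr_ge0 // oppr_ge0 ltW.
pose g := c - a *: c'.
suff: W *m g = 0 by rewrite /g mulmxBr -scalemxAr => /eqP; rewrite subr_eq0 => /eqP.
pose B := col_mx (tight_rows W c) (row i W).
have BW : (B <= W)%MS by rewrite col_mx_sub tight_rows_sub row_sub.
have TB : (tight_rows W c < B)%MS.
  rewrite ltmxE; have : (B <= B)%MS by []; rewrite col_mx_sub => /andP[-> iB] /=.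
  by apply: contra ni; apply: submx_trans.
have : (W <= B)%MS.
  by rewrite -(mxrank_leqif_sup BW) eqn_leq mxrankS //= rankW -rc; apply: rank_ltmx.
move=> /submxP[D ->]; rewrite -mulmxA mul_col_mx.
have -> : tight_rows W c *m g = 0.
  rewrite /g mulmxBr -scalemxAr tight_rows_mul (eq_tight_rows tE) tight_rows_mul.
  by rewrite scaler0 subrr.
have -> : row i W *m g = 0.
  apply/rowP => k; rewrite ord1 mulmx_row_entry /g mulmxBr -scalemxAr.
  have -> (x y : 'cV[R]_m) : (x - a *: y) i 0 = x i 0 - a * y i 0 by rewrite !mxE.
  by rewrite /a divfK ?lt_eqF // subrr mxE.
by rewrite col_mx0 mulmx0.
Qed.

(** By [valid_cone_ind] only two cases remain: functionals vanishing on all rays, and those of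
    corank one, which [allC] and [corank1_proportional] make multiples of a column of [C]. *)
Lemma valid_conic c : valid_at W c ->
  exists2 l : 'cV[R]_n, forall j, 0 <= l j 0 & W *m c = K *m l.
Proof.
move: c; apply: valid_cone_ind.
- by move=> c ->; exists 0; [move=> j; rewrite mxE|rewrite mulmx0].
- move=> c vc; rewrite rankW => rc; have [j tj] := allC vc rc.
  have [a a0 E] := corank1_proportional vc (validC j) rc tj.
  exists (a *: delta_mx j 0).
    by move=> k; rewrite !mxE mulr_ge0 // ler0n.
  by rewrite E -scalemxAr [col j C]colE mulmxA.
- move=> c c' a a' a0 a'0 [l l0 E] [l' l'0 E'].
  exists (a *: l + a' *: l').
    by move=> j; rewrite !mxE addr_ge0 ?mulr_ge0.
  by rewrite !mulmxDr -!scalemxAr E E'.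
Qed.

Lemma valid_perturb c g : valid_at W c -> (forall i, tight W c i -> (W *m g) i 0 = 0) ->
  exists2 eps : R, 0 < eps & valid_at W (c + eps *: g).
Proof.
move=> vc tg.
have [eps e0 H] := small_perturbation (fun i => (W *m c) i 0) (fun i => (W *m g) i 0).
exists eps => // i; rewrite mulmxDr -scalemxAr.
have -> (x y : 'cV[R]_m) : (x + eps *: y) i 0 = x i 0 + eps * y i 0 by rewrite !mxE.
have [ti|nt] := boolP (tight W c i); first by rewrite tg // mulr0 addr0.
by apply/ltW/H; rewrite lt_neqAle vc andbT.
Qed.

(** A strictly exposing functional is interior to the valid cone, so any [g] is a multiple of the
    difference of two valid functionals. *)
Lemma functional_span g : exists mu : 'cV[R]_n, W *m g = K *m mu.
Proof.
have [c0 ex0] := exposed.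
have row0 (h : 'cV[R]_d) i : row i W = 0 -> (W *m h) i 0 = 0.
  by move=> E; rewrite -mulmx_row_entry E mul0mx mxE.
have v0 : valid_at W c0.
  by move=> i; have [/row0 ->|/ex0/ltW] := eqVneq (row i W) 0.
have [eps e0 ve] : exists2 eps : R, 0 < eps & valid_at W (c0 + eps *: g).
  apply: valid_perturb => // i ti; apply: row0; apply/eqP.
  by apply: contraTT ti => /ex0; rewrite /tight lt_neqAle => /andP[].
have [l _ E] := valid_conic v0; have [l' _ E'] := valid_conic ve.
exists (eps^-1 *: (l' - l)); rewrite -scalemxAr mulmxBr -E -E' mulmxDr -scalemxAr.
by rewrite addrC addKr scalerA mulVf ?scale1r // gt_eqF.
Qed.

Lemma rankK : \rank K = n.
Proof.
apply/eqP; rewrite eqn_leq rank_leq_col /= -{1}rankW.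
have [M HM] := fin_all_exists (fun j : 'I_d => functional_span (delta_mx j 0)).
have -> : W = K *m \matrix_(i, j) M j i 0.
  apply/matrixP => i j; have := HM j; rewrite -colE => /colP/(_ i); rewrite mxE => ->.
  by rewrite !mxE; apply: eq_bigr => k _; rewrite !mxE.
exact: mxrankM_maxl.
Qed.

Lemma K_inj (mu nu : 'cV[R]_n) : K *m mu = K *m nu -> mu = nu.
Proof.
move=> E; apply: trmx_inj; apply: (@row_free_inj _ _ _ _ K^T).
  by rewrite /row_free mxrank_tr rankK.
by rewrite -!trmx_mul E.
Qed.

Lemma rank_mulC p (A : 'M[R]_(p, d)) : (A <= W)%MS -> \rank (A *m C) = \rank A.
Proof.
move=> AW; have := mxrank_mul_ker A C; have := mxrank_mul_ker W C.
rewrite -/K rankK rankW => /eqP; rewrite -[X in _ == X]addn0 eqn_add2l => /eqP k0.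
have : (\rank (A :&: kermx C) <= \rank (W :&: kermx C))%N by rewrite mxrankS // capmxS.
by rewrite k0 leqn0 => /eqP ->; rewrite addn0.
Qed.

Lemma tight_conic (l : 'cV[R]_n) i : (forall j, 0 <= l j 0) ->
  tight W (C *m l) i = [forall j, (l j 0 != 0) ==> (K i j == 0)].
Proof.
move=> l0; rewrite /tight mulmxA mxE -oppr_eq0 -sumrN psumr_eq0; last first.
  by move=> j _; rewrite oppr_ge0 mulr_le0_ge0 // K_le0.
rewrite -big_all big_andE; apply: eq_forallb => j /=.
by rewrite oppr_eq0 mulf_eq0 orbC implybE negbK.
Qed.

(** By [tight_conic] only the support of a conic combination matters for tightness, so subsets of
    the [n] facets represent all faces through the vertex. *)
Definition indicator (J : {set 'I_n}) : 'cV[R]_n := \col_j (j \in J)%:R.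

Lemma indicator_ge0 J j : 0 <= indicator J j 0.
Proof. by rewrite mxE ler0n. Qed.

Lemma valid_indicator J : valid_at W (C *m indicator J).
Proof.
move=> i; rewrite mulmxA mxE; apply: sumr_le0 => j _.
by rewrite mulr_le0_ge0 // ?K_le0 // indicator_ge0.
Qed.

Lemma tight_indicator J i :
  tight W (C *m indicator J) i = [forall j in J, K i j == 0].
Proof.
rewrite tight_conic; last exact: indicator_ge0.
by apply: eq_forallb => j; rewrite mxE; case: (j \in J); rewrite ?oner_eq0 ?eqxx.
Qed.

Lemma valid_tight_indicator c : valid_at W c ->
  exists J, tight W c =1 tight W (C *m indicator J).
Proof.
move=> vc; have [l l0 E] := valid_conic vc.
exists [set j | l j 0 != 0] => i; rewrite tight_indicator.
have -> : tight W c i = tight W (C *m l) i by rewrite /tight mulmxA -/K -E.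
by rewrite tight_conic //; apply: eq_forallb => j; rewrite inE.
Qed.

(** A small move along [C *m mu] stays valid, and coefficients are unique by [K_inj]; so off [J],
    where [indicator J] vanishes, [mu] is nonnegative. The same holds for [- mu]. *)
Lemma kernel_tight_indicator J (mu : 'cV[R]_n) :
  tight_rows W (C *m indicator J) *m (C *m mu) = 0 -> forall j, j \notin J -> mu j 0 = 0.
Proof.
move=> T0 j jJ.
have key (nu : 'cV[R]_n) : tight_rows W (C *m indicator J) *m (C *m nu) = 0 -> 0 <= nu j 0.
  move=> /tight_rowsP T.
  have [eps e0 ve] : exists2 eps : R, 0 < eps &
      valid_at W (C *m indicator J + eps *: (C *m nu)).
    apply: valid_perturb; first exact: valid_indicator.
    by move=> i /T E; rewrite -mulmx_row_entry E mxE.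
  have [l l0 E] := valid_conic ve.
  have /colP/(_ j) : indicator J + eps *: nu = l.
    by apply: K_inj; rewrite -E !mulmxDr -!scalemxAr !mulmxA.
  by have := l0 j => /[swap] <-; rewrite !mxE (negPf jJ) add0r pmulr_rge0.
apply/eqP; rewrite eq_le key // andbT -oppr_ge0.
have -> : - mu j 0 = (- mu) j 0 by rewrite mxE.
by apply: key; rewrite !mulmxN T0 oppr0.
Qed.

(** The functionals [C *m mu] killing the tight rows are exactly those with [mu] supported on [J], a
    space of dimension [#|J|]; and [C] preserves ranks below [W]. *)
Lemma rank_tight_indicator J : (\rank (tight_rows W (C *m indicator J)) + #|J|)%N = n.
Proof.
pose T := tight_rows W (C *m indicator J).
pose E := rowsub (fun i : 'I_#|J| => enum_val i) (1%:M : 'M[R]_n).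
have EK : \rank (kermx (T *m C)^T) = #|J|.
  rewrite -(mxrank_rowsub1 R J); apply/eqP; rewrite eqn_leq !mxrankS //.
    apply/sub_kermxP; rewrite -[LHS]trmxK trmx_mul trmxK; apply/eqP; rewrite trmx_eq0.
    rewrite -mulmxA; apply/eqP/tight_rowsP => i; rewrite tight_indicator => /forall_inP ti.
    rewrite mulmxA -row_mul -/K; apply/rowP => k; rewrite [RHS]mxE mxE big1 // => j _.
    have -> : row i K 0 j = K i j by rewrite mxE.
    have -> : E^T j k = (enum_val k == j)%:R by rewrite !mxE.
    case: eqP => [<-|]; last by rewrite mulr0.
    by rewrite (eqP (ti _ (enum_valP _))) mul0r.
  apply/row_subP => k; apply/sub_rowsub1P => j jJ.
  have : row k (kermx (T *m C)^T) *m (T *m C)^T = 0 by apply/sub_kermxP; rewrite row_sub.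
  move/(congr1 trmx); rewrite trmx_mul trmxK trmx0 -mulmxA.
  by move/kernel_tight_indicator/(_ j jJ); rewrite mxE.
have := EK; rewrite mxrank_ker mxrank_tr rank_mulC ?tight_rows_sub // => <-.
rewrite -/T subnKC //; have := mxrankS (tight_rows_sub W (C *m indicator J)).
by rewrite rankW.
Qed.

End SimpleVertex.

(** * Faces of simple polytopes *)

From mathcomp Require Import finmap.
From mathcomp Require Import boolp classical_sets functions cardinality reals.

Local Open Scope classical_set_scope.
Local Open Scope ring_scope.

Lemma card_eq_finset (T : finType) (S : {set T}) : ([set` S] #= `I_#|S|)%card.
Proof.
have -> : [set` S] = [set` [fset x in enum S]%fset].
  by apply/seteqP; split=> x /=; rewrite in_fset mem_enum.
by apply/card_eq_fsetP; rewrite card_fseq undup_id ?enum_uniq // cardE.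
Qed.

Lemma card_fset_set_image (T : finType) (U : choiceType) (S : {set T}) (f : T -> U) :
  {in S &, injective f} -> #|` fset_set (f @` [set` S])| = #|S|.
Proof.
move=> injf; apply: card_fset_set; apply: card_eq_trans (card_eq_finset S).
by apply: inj_card_eq => x y; rewrite !inE /= => xS yS; apply: injf.
Qed.

(** * Dimensions and exposed faces of a polytope *)

Section Dimension.
Variables (R : realType) (d : nat).
Implicit Types (F G P : set 'rV[R]_d).

Definition has_simplex F k : Prop :=
  exists2 p : 'I_k.+1 -> 'rV[R]_d, affine_independent p & forall i, F (p i).

Lemma has_simplex_leq F k l : (l <= k)%N -> has_simplex F k -> has_simplex F l.
Proof.
move=> lk [p fp Fp]; have lk1 : (l.+1 <= k.+1)%N by [].
exists (p \o widen_ord lk1) => [|i]; last exact: Fp.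
rewrite /affine_independent.
have -> : \matrix_(i < l) ((p \o widen_ord lk1) (lift ord0 i) - (p \o widen_ord lk1) ord0)
    = rowsub (widen_ord lk) (\matrix_(i < k) (p (lift ord0 i) - p ord0)).
  apply/row_matrixP => i; rewrite row_rowsub !rowK /=.
  by congr (p _ - p _); apply: val_inj.
by apply: row_free_rowsub => // i j /(congr1 val) /= /val_inj.
Qed.

Lemma has_dimE F k : has_dim F k -> forall l, has_simplex F l <-> (l <= k)%N.
Proof.
move=> [Fk nFk] l; split=> [Fl|lk]; last exact: has_simplex_leq Fk.
by rewrite leqNgt; apply/negP => kl; apply: nFk; apply: has_simplex_leq Fl.
Qed.

Lemma has_dim_uniq F k l : has_dim F k -> has_dim F l -> k = l.
Proof.
move=> hk hl; apply/eqP; rewrite eqn_leq.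
by apply/andP; split; [apply/(has_dimE hl)/(has_dimE hk)|apply/(has_dimE hk)/(has_dimE hl)].
Qed.

Lemma has_dim_nonempty F k : has_dim F k -> F !=set0.
Proof. by move=> [[p _ Fp] _]; exists (p ord0). Qed.

Lemma has_dim_rank F k : (forall l, has_simplex F l <-> (l <= k)%N) -> has_dim F k.
Proof. by move=> H; split; [apply/H|move=> /H; rewrite ltnn]. Qed.

End Dimension.

Section Polytope.
Variables (R : realType) (d m : nat) (V : 'I_m -> 'rV[R]_d).
Implicit Types (c : 'cV[R]_d) (x v : 'rV[R]_d).

Let P : set 'rV[R]_d := [set x | exists t : 'I_m -> R,
          [/\ forall i, 0 <= t i, \sum_i t i = 1 & x = \sum_i t i *: V i]].

Definition rays v : 'M[R]_(m, d) := \matrix_i (V i - v).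

Definition exposed_face v c : set 'rV[R]_d := P `&` [set x | (x *m c) 0 0 = (v *m c) 0 0].

Lemma polytope_vertex i : P (V i).
Proof.
exists (fun j => (j == i)%:R); split; first by move=> j; rewrite ler0n.
  by rewrite (bigD1 i) //= eqxx big1 ?addr0 // => j /negPf ->.
by rewrite (bigD1 i) //= eqxx scale1r big1 ?addr0 // => j /negPf ->; rewrite scale0r.
Qed.

Lemma rays_entry v c i : (rays v *m c) i 0 = (V i *m c) 0 0 - (v *m c) 0 0.
Proof. by rewrite -mulmx_row_entry rowK mulmxBl !mxE. Qed.

Lemma polytope_rays v x : P x -> exists2 t : 'rV[R]_m, forall i, 0 <= t 0 i & x - v = t *m rays v.
Proof.
move=> [t [t0 t1 ->]]; exists (\row_i t i); first by move=> i; rewrite mxE.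
have vE : v = \sum_i t i *: v by rewrite -scaler_suml t1 scale1r.
rewrite {1}vE -sumrB; apply/rowP => j.
rewrite !mxE summxE; apply: eq_bigr => i _; rewrite !mxE; ring.
Qed.

Lemma valid_polytope v c x : valid_at (rays v) c -> P x -> (x *m c) 0 0 <= (v *m c) 0 0.
Proof.
move=> vc /(polytope_rays v)[t t0 E]; rewrite -subr_le0.
have -> : (x *m c) 0 0 - (v *m c) 0 0 = (t *m (rays v *m c)) 0 0.
  by rewrite mulmxA -E mulmxBl !mxE.
by rewrite mxE; apply: sumr_le0 => i _; rewrite mulr_ge0_le0.
Qed.

Lemma valid_at_rays v c : (forall x, P x -> (x *m c) 0 0 <= (v *m c) 0 0) -> valid_at (rays v) c.
Proof. by move=> H i; rewrite rays_entry subr_le0; apply/H/polytope_vertex. Qed.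

Lemma tight_rays v c i : tight (rays v) c i = ((V i *m c) 0 0 == (v *m c) 0 0).
Proof. by rewrite /tight rays_entry subr_eq0. Qed.

(** The value of [c] on [x - v] is a sum of nonpositive terms, which vanishes only if every term
    does. *)
Lemma exposed_faceP v c x : valid_at (rays v) c -> P x ->
  exposed_face v c x <-> exists2 t : 'rV[R]_m, (forall i, 0 <= t 0 i) /\
    (forall i, t 0 i != 0 -> tight (rays v) c i) & x - v = t *m rays v.
Proof.
move=> vc Px.
have dot t : x - v = t *m rays v -> (x *m c) 0 0 - (v *m c) 0 0 = \sum_i t 0 i * (rays v *m c) i 0.
  move=> E; transitivity ((t *m (rays v *m c)) 0 0); last by rewrite mxE.
  by rewrite mulmxA -E mulmxBl !mxE.
split=> [[_ /= xc]|[t [t0 tt] E]].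
  have [t t0 E] := polytope_rays v Px; exists t => //; split=> // i ti.
  move: (dot _ E); rewrite xc subrr => /esym/eqP.
  rewrite -oppr_eq0 -sumrN psumr_eq0; last by move=> j _; rewrite oppr_ge0 mulr_ge0_le0.
  by move=> /allP/(_ i (mem_index_enum i)); rewrite oppr_eq0 mulf_eq0 (negPf ti).
split=> //=; apply/eqP; rewrite -subr_eq0 (dot _ E) big1 // => i _.
by have [->|/tt/eqP ->] := eqVneq (t 0 i) 0; rewrite ?mul0r ?mulr0.
Qed.

Lemma exposed_face_tight v c c' : valid_at (rays v) c -> valid_at (rays v) c' ->
  (forall i, tight (rays v) c i -> tight (rays v) c' i) ->
  exposed_face v c `<=` exposed_face v c'.
Proof.
move=> vc vc' tE x Gx; have Px : P x by case: Gx.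
have [t [t0 tt] E] := (exposed_faceP vc Px).1 Gx.
by apply/(exposed_faceP vc' Px); exists t => //; split=> // i /tt/tE.
Qed.

Lemma eq_exposed_face v c c' : valid_at (rays v) c -> valid_at (rays v) c' ->
  tight (rays v) c =1 tight (rays v) c' -> exposed_face v c = exposed_face v c'.
Proof.
by move=> vc vc' tE; apply/seteqP; split; apply: exposed_face_tight => // i; rewrite tE.
Qed.

(** All differences from [v] within the face lie in the span of the tight rays; conversely [v] and a
    maximal independent family of tight rays give a simplex. *)
Lemma exposed_face_dim v c : P v -> valid_at (rays v) c ->
  has_dim (exposed_face v c) (\rank (tight_rows (rays v) c)).
Proof.
move=> Pv vc; set T := tight_rows _ _; apply: has_dim_rank => l; split.
  move=> [p fp Gp]; rewrite -(eqP fp); apply: mxrankS.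
  have sub i : (p i - v <= T)%MS.
    have Px : P (p i) by case: (Gp i).
    have [t [t0 tt] ->] := (exposed_faceP vc Px).1 (Gp i).
    apply/submxP; exists t; rewrite !mulmx_sum_row; apply: eq_bigr => j _.
    have [->|/tt tj] := eqVneq (t 0 j) 0; first by rewrite !scale0r.
    by rewrite row_tight.
  apply/row_subP => i; rewrite rowK.
  have -> : p (lift ord0 i) - p ord0 = (p (lift ord0 i) - v) - (p ord0 - v).
    by rewrite opprB addrA subrK.
  by rewrite addmx_sub // eqmx_opp.
move=> lr; apply: has_simplex_leq lr _.
pose f := maxrankfun T.
(* An independent row is nonzero, hence not one of the zeroed slack rows. *)
have tf i : tight (rays v) c (f i).
  have : row i (rowsub f T) != 0.
    apply/negP => /eqP E; have := maxrowsub_free T; rewrite -kermx_eq0 => /eqP K0.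
    have : (delta_mx 0 i : 'rV[R]_(\rank T)) *m rowsub f T = 0 by rewrite -rowE.
    move=> /sub_kermxP; rewrite K0 submx0 => /eqP/rowP/(_ i).
    by rewrite !mxE !eqxx => /eqP; rewrite oner_eq0.
  by rewrite row_rowsub rowK; case: ifP => //; rewrite eqxx.
exists (fun i => if unlift ord0 i is Some j then V (f j) else v).
  rewrite /affine_independent (_ : \matrix_i _ = rowsub f T); first exact: maxrowsub_free.
  by apply/row_matrixP => i; rewrite row_rowsub !rowK liftK unlift_none tf.
move=> i; case: unliftP => [j _|_]; split=> //=; first exact: polytope_vertex.
by apply/eqP; rewrite -tight_rays.
Qed.

(* Tilting [c] towards the vertex of largest norm on the face exposes that vertex. *)
Lemma face_vertex c b : (forall x, P x -> (x *m c) 0 0 <= b) ->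
  P `&` [set x | (x *m c) 0 0 = b] !=set0 ->
  exists2 i0, (V i0 *m c) 0 0 = b &
    exists c' : 'cV[R]_d, forall i, row i (rays (V i0)) != 0 -> (rays (V i0) *m c') i 0 < 0.
Proof.
move=> vb [x [Px /= xb]].
have vx : valid_at (rays x) c by apply: valid_at_rays => y /vb; rewrite xb.
have [t [t0 t1 xE]] := Px.
(* Averaging over the convex combination [x], every generator of nonzero weight attains the maximum
   of [c]. *)
have [j tj] : exists j, tight (rays x) c j.
  have [i ti] : exists i, t i != 0.
    apply/existsP; apply: contraT; rewrite negb_exists => /forallP H.
    move/eqP: t1; rewrite big1 ?(eq_sym 0) ?oner_eq0 // => i _.
    by have := H i; rewrite negbK => /eqP.
  exists i; have : \sum_k t k * (rays x *m c) k 0 = 0.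
    under eq_bigr do rewrite rays_entry mulrBr.
    rewrite sumrB -mulr_suml t1 mul1r xE mulmx_suml summxE.
    by under [X in _ - X]eq_bigr do rewrite -scalemxAl mxE; rewrite subrr.
  move/eqP; rewrite -oppr_eq0 -sumrN psumr_eq0; last by move=> k _; rewrite oppr_ge0 mulr_ge0_le0.
  by move=> /allP/(_ i (mem_index_enum i)); rewrite oppr_eq0 mulf_eq0 (negPf ti).
have {}tj : (V j *m c) 0 0 == b by move: tj; rewrite tight_rays xb.
pose sq i := (V i *m (V i)^T) 0 0.
case: (@Order.TotalTheory.arg_maxP _ _ _ j (fun i => (V i *m c) 0 0 == b) sq tj) => i0 /eqP vi0 maxi.
exists i0 => //.
have [eps e0 H] := small_perturbation (fun i => (rays (V i0) *m c) i 0)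
  (fun i => (rays (V i0) *m (V i0)^T) i 0).
exists (c + eps *: (V i0)^T) => i; rewrite rowK => Vi.
have -> : (rays (V i0) *m (c + eps *: (V i0)^T)) i 0
    = (rays (V i0) *m c) i 0 + eps * (rays (V i0) *m (V i0)^T) i 0.
  by rewrite mulmxDr -scalemxAr !mxE.
have : (rays (V i0) *m c) i 0 <= 0.
  by rewrite rays_entry vi0 subr_le0; apply/vb/polytope_vertex.
rewrite le_eqVlt => /orP[/eqP ci|]; last exact: H.
rewrite ci add0r pmulr_rlt0 // rays_entry subr_lt0.
(* Expanding this positive squared distance and using that the norm of [V i] is at most that of
   [V i0] makes the inner product of [V i - V i0] with [V i0] negative. *)
have pos : 0 < ((V i - V i0) *m (V i - V i0)^T) 0 0.
  rewrite mxE lt_def sumr_ge0 ?andbT; last by move=> k _; rewrite !mxE -expr2 sqr_ge0.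
  apply: contraNneq Vi => /eqP; rewrite psumr_eq0; last first.
    by move=> k _; rewrite !mxE -expr2 sqr_ge0.
  move=> /allP Z; apply/eqP/rowP => k; have := Z k (mem_index_enum k).
  by rewrite !mxE /= mulf_eq0 orbb => /eqP.
have sym : (V i0 *m (V i)^T) 0 0 = (V i *m (V i0)^T) 0 0.
  by rewrite -[in LHS](trmxK (V i0)) -trmx_mul mxE.
have le : sq i <= sq i0.
  by apply: maxi; rewrite -vi0 -subr_eq0 -rays_entry ci.
move: pos; rewrite linearB /= mulmxBl !mulmxBr.
have BE (a b' : 'M[R]_1) : (a - b') 0 0 = a 0 0 - b' 0 0 by rewrite !mxE.
by rewrite !BE sym; move: le; rewrite /sq; lra.
Qed.

End Polytope.

(** * Faces as intersections of facets *)

Section SimplePolytope.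
Variables (R : realType) (d n : nat) (P : set 'rV[R]_d).
Hypothesis simpleP : simple_polytope n P.
Variables (I : finType) (D : pred I) (phi : I -> set 'rV[R]_d).
Hypothesis phi_bij : set_bij [set A | D A] (facets n P) phi.

(** Intersecting with [P] makes the empty family give [P] itself. *)
Definition facet_inter (S : {set I}) : set 'rV[R]_d := P `&` \bigcap_(A in [set` S]) phi A.

Lemma facet_functionals : exists f : I -> 'cV[R]_d * R, forall A, D A ->
  (forall x, P x -> (x *m (f A).1) 0 0 <= (f A).2) /\
  phi A = P `&` [set x | (x *m (f A).1) 0 0 = (f A).2].
Proof.
have H A : exists y : 'cV[R]_d * R, D A ->
    (forall x, P x -> (x *m y.1) 0 0 <= y.2) /\ phi A = P `&` [set x | (x *m y.1) 0 0 = y.2].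
  have [DA|nDA] := boolP (D A); last by exists (0, 0).
  have [phiD _ _] := phi_bij.
  have [[c [b cb]] _] : facets n P (phi A) by apply: phiD.
  by exists (c, b).
by have [f Hf] := fin_all_exists H; exists f.
Qed.

(** Add up the functionals and bounds of the facets: equality in the sum forces equality in each. *)
Lemma facet_inter_face (S : {set I}) : (forall A, A \in S -> D A) -> is_face P (facet_inter S).
Proof.
move=> SD; have [f Hf] := facet_functionals.
exists (\sum_(A in S) (f A).1), (\sum_(A in S) (f A).2).
have dot x : (x *m \sum_(A in S) (f A).1) 0 0 = \sum_(A in S) (x *m (f A).1) 0 0.
  by rewrite mulmx_sumr summxE.
split=> [x Px|]; first by rewrite dot; apply: ler_sum => A /SD/Hf[/(_ x Px)].
apply/seteqP; split=> x [Px /= H]; split=> //=.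
  rewrite dot; apply: eq_bigr => A AS; have := H A AS.
  by have [_ ->] := Hf A (SD A AS); case.
move=> A /= AS; have [_ ->] := Hf A (SD A AS); split=> //=.
move: H; rewrite dot => /eqP; rewrite eq_sym -subr_eq0 -sumrB psumr_eq0; last first.
  by move=> B /SD/Hf[/(_ x Px)]; rewrite subr_ge0.
by move=> /allP/(_ A (mem_index_enum A)); rewrite AS /= subr_eq0 => /eqP.
Qed.

(* [v] is a vertex of [G] and [h] enumerates the facets through it. *)
Lemma face_vertex_structure (G : set 'rV[R]_d) : is_face P G -> G !=set0 ->
  exists (v : 'rV[R]_d) (h : 'I_n -> I), [/\ G v, injective h, forall j, D (h j),
    forall A, D A -> phi A v -> exists j, A = h j &
    exists rk : {set 'I_n} -> nat, (forall J, (rk J + #|J|)%N = n) /\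
      (forall J : {set 'I_n}, has_dim (facet_inter (h @: J)) (rk J)) /\
      (forall G', is_face P G' -> G' v -> exists J : {set 'I_n}, G' = facet_inter (h @: J))].
Proof.
move=> [c [b [vb GE]]] G0; have [polyP dimP vertP] := simpleP.
have [m [V PE]] := polyP.
have [||i0 vi0 [c0 exc0]] := @face_vertex _ _ _ V c b.
- by move=> x; rewrite -PE; apply: vb.
- by rewrite -PE -GE.
pose v := V i0; pose W := rays V v.
have Pv : P v by rewrite PE; apply: polytope_vertex.
have Gv : G v by rewrite GE; split.
have validW c' : (forall x, P x -> (x *m c') 0 0 <= (v *m c') 0 0) -> valid_at W c'.
  by move=> H; apply: valid_at_rays => x; rewrite -PE; apply: H.
have faceW c' : valid_at W c' -> is_face P (exposed_face V v c').
  move=> vc'; exists c', ((v *m c') 0 0); split; last by rewrite PE.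
  by move=> x; rewrite PE; apply: valid_polytope.
have dimW c' : valid_at W c' -> has_dim (exposed_face V v c') (\rank (tight_rows W c')).
  by move=> vc'; apply: exposed_face_dim => //; rewrite -PE.
have Gvv c' : exposed_face V v c' v by split; [rewrite -PE|].
have v0 : valid_at W 0 by move=> i; rewrite mulmx0 mxE.
(* The zero functional exposes all of [P] and makes every row tight. *)
have rankW : \rank W = n.
  apply: has_dim_uniq dimP.
  have -> : W = tight_rows W 0.
    by apply/row_matrixP => i; rewrite row_tight // /tight mulmx0 mxE.
  have -> : P = exposed_face V v 0.
    apply/seteqP; rewrite PE; split=> x; last by case.
    by move=> Px; split=> /=; [|rewrite !mulmx0].
  exact: dimW.
have vc0 : valid_at W c0.
  move=> i; have [E|/exc0/ltW//] := eqVneq (row i W) 0.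
  by rewrite -mulmx_row_entry E mul0mx mxE.
have vertex_v : exposed_face V v c0 = [set v].
  apply/seteqP; split=> [x Gx|_ -> /=]; last exact: Gvv.
  have Px : P x by rewrite PE; case: Gx.
  rewrite PE in Px; have [t [_ tt] E] := (exposed_faceP vc0 Px).1 Gx.
  apply/eqP; rewrite -subr_eq0 E mulmx_sum_row big1 // => i _.
  have [->|/tt ti] := eqVneq (t 0 i) 0; first by rewrite scale0r.
  have [->|/exc0] := eqVneq (row i W) 0; first by rewrite scaler0.
  by move: ti; rewrite /tight => /eqP ->; rewrite ltxx.
have dim_v : faces_of_dim P 0 [set v].
  rewrite -vertex_v; split; first exact: faceW.
  have := dimW _ vc0; rewrite (_ : tight_rows W c0 = 0) ?mxrank0 //.
  apply/row_matrixP => i; rewrite rowK row0; case: ifP => // ti.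
  have [//|/exc0] := eqVneq (row i W) 0.
  by move: ti; rewrite /tight => /eqP ->; rewrite ltxx.
have [phiD phi_inj phi_surj] := phi_bij.
(* Simplicity enters here: [{v}] is a face of dimension zero, so exactly [n] facets pass through
   [v]. *)
pose Dv := [set A : I | D A && `[< phi A v >]]%SET.
have cardDv : #|Dv| = n.
  apply/card_eq_II; apply: card_eq_trans (vertP _ dim_v); rewrite card_eq_sym.
  have -> : [set F | facets n P F /\ [set v] `<=` F] = phi @` [set` Dv].
    apply/seteqP; split=> F.
      move=> [/phi_surj[A DA <-] vA]; exists A => //=; rewrite inE; apply/andP; split=> //.
      by apply/asboolP/vA.
    move=> [A /=]; rewrite inE => /andP[DA /asboolP Av] <-; split; first exact: phiD.
    by move=> _ ->.
  apply: card_eq_trans (card_eq_finset Dv).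
  apply: inj_card_eq => A B; rewrite !in_setE /= !inE => /andP[DA _] /andP[DB _].
  by apply: phi_inj; rewrite in_setE.
pose h (j : 'I_n) : I := enum_val (cast_ord (esym cardDv) j).
have hDv j : h j \in Dv by apply: enum_valP.
have h_inj : injective h by move=> i j /enum_val_inj/cast_ord_inj.
have h_surj A : D A -> phi A v -> exists j, A = h j.
  move=> DA Av; have ADv : A \in Dv by rewrite inE DA; apply/asboolP.
  exists (cast_ord cardDv (enum_rank_in ADv A)).
  by rewrite /h cast_ordK enum_rankK_in.
have [f Hf] := facet_functionals.
pose C : 'M[R]_(d, n) := \matrix_(i, j) (f (h j)).1 i 0.
have colC j : col j C = (f (h j)).1 by apply/colP => i; rewrite !mxE.
have hE j : [/\ D (h j), valid_at W (col j C) & phi (h j) = exposed_face V v (col j C)].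
  have := hDv j; rewrite inE => /andP[Dh /asboolP vh].
  have [vf fE] := Hf _ Dh; rewrite colC.
  have bE : (v *m (f (h j)).1) 0 0 = (f (h j)).2 by move: vh; rewrite fE; case.
  split=> //; last by rewrite fE -bE PE.
  by apply: validW => x /vf; rewrite bE.
have validC j : valid_at W (col j C) by case: (hE j).
(* Corank one means that the exposed face is a facet through [v], hence listed by [h]; tightness of
   row [i] only records whether [V i] lies on the face. *)
have allC c' : valid_at W c' -> (\rank (tight_rows W c')).+1 = n ->
    exists j, tight W c' =1 tight W (col j C).
  move=> vc' rc'; have : facets n P (exposed_face V v c').
    by split; [apply: faceW|rewrite -[in X in has_dim _ X]rc'; apply: dimW].
  move=> /phi_surj[A DA EA].
  have [j Aj] : exists j, A = h j.
    by apply: h_surj => //; rewrite EA.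
  have [_ _ Ej] := hE j; exists j => i; rewrite !tight_rays.
  have tE c1 : ((V i *m c1) 0 0 == (v *m c1) 0 0) = `[< exposed_face V v c1 (V i) >].
    apply/eqP/asboolP => [H|[]//]; split=> //; exact: polytope_vertex.
  by rewrite !tE -EA -Ej Aj.
have exW : exists c1 : 'cV[R]_d, forall i, row i W != 0 -> (W *m c1) i 0 < 0 by exists c0.
pose ind (J : {set 'I_n}) := C *m indicator R J.
have vind J : valid_at W (ind J) by apply: valid_indicator.
have interE (J : {set 'I_n}) : facet_inter (h @: J) = exposed_face V v (ind J).
  apply/seteqP; split=> x.
    move=> [Px H]; split; first by rewrite -PE.
    apply/eqP; rewrite /= -subr_eq0 /ind.
    have -> : (x *m (C *m indicator R J)) 0 0 - (v *m (C *m indicator R J)) 0 0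
        = (((x - v) *m C) *m indicator R J) 0 0 by rewrite -mulmxA mulmxBl !mxE.
    rewrite mxE big1 // => j _; have [jJ|jJ] := boolP (j \in J); last first.
      by rewrite [indicator R J j 0]mxE (negPf jJ) mulr0.
    have : phi (h j) x by apply: H => /=; apply: imset_f.
    have [_ _ ->] := hE j; move=> [_ /= xv].
    have -> : ((x - v) *m C) 0 j = ((x - v) *m col j C) 0 0.
      by rewrite colE mulmxA -colE [RHS]mxE.
    have -> : ((x - v) *m col j C) 0 0 = (x *m col j C) 0 0 - (v *m col j C) 0 0.
      by rewrite mulmxBl !mxE.
    by rewrite xv subrr mul0r.
  move=> Gx; split; first by rewrite PE; case: Gx.
  move=> _ /= /imsetP[j jJ ->]; have [_ _ ->] := hE j.
  apply: (exposed_face_tight (vind J)) Gx => // i; rewrite -/W /ind tight_indicator //.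
  move=> /forall_inP/(_ j jJ); rewrite /tight colE mulmxA -colE.
  by rewrite [(col _ _) _ _]mxE.
exists v, h; split=> //; first by move=> j; case: (hE j).
exists (fun J => \rank (tight_rows W (ind J))); split; [|split].
- by move=> J; apply: rank_tight_indicator.
- by move=> J; rewrite interE; apply: dimW.
move=> G' [c1 [b1 [vb1 G'E]]] G'v.
have vc1 : (v *m c1) 0 0 = b1 by move: G'v; rewrite G'E; case.
have valc1 : valid_at W c1 by apply: validW => x /vb1; rewrite vc1.
have [J HJ] := valid_tight_indicator rankW validC allC valc1.
exists J; rewrite interE G'E -vc1 PE; exact: eq_exposed_face.
Qed.

Lemma facet_inter_dim (S : {set I}) : (forall A, A \in S -> D A) -> facet_inter S !=set0 ->
  (exists2 k, (k + #|S|)%N = n & has_dim (facet_inter S) k) /\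
  (forall A, D A -> facet_inter S `<=` phi A -> A \in S).
Proof.
move=> SD S0.
have [v [h [Gv h_inj Dh h_surj [rk [rkE [dimE _]]]]]] :=
  face_vertex_structure (facet_inter_face SD) S0.
pose J := h @^-1: S.
have SE : S = h @: J.
  apply/setP => A; apply/idP/imsetP => [AS|[j]]; last by rewrite inE => ? ->.
  have [j Aj] : exists j, A = h j.
    by apply: h_surj; [exact: SD|case: Gv => _; apply].
  by exists j; rewrite // inE -Aj.
split; first by exists (rk J); [rewrite [in #|S|]SE card_imset|rewrite SE].
move=> A DA sub; have [j Aj] := h_surj A DA (sub _ Gv).
(* Adding a missing [A] would leave the intersection unchanged while lowering its dimension by
   one. *)
apply/negPn/negP => AS; have jJ : j \notin J by rewrite inE -Aj.
have E : facet_inter (h @: (j |: J)) = facet_inter (h @: J).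
  rewrite -SE; apply/seteqP; split=> x.
    move=> [Px H]; split=> // B /= BS; apply: H => /=; move: BS; rewrite SE.
    by move=> /imsetP[k kJ ->]; apply: imset_f; rewrite setU1r.
  move=> Gx; split; first by case: Gx.
  move=> _ /= /imsetP[k /setU1P[->|kJ] ->]; first by rewrite -Aj; apply: sub.
  by case: Gx => _; apply; rewrite /= SE imset_f.
have := has_dim_uniq (dimE (j |: J)%SET) (eq_ind_r (fun F => has_dim F _) (dimE J) E).
by have := rkE J; have := rkE (j |: J)%SET; rewrite cardsU1 jJ; lia.
Qed.

Lemma face_facet_inter G : is_face P G -> G !=set0 ->
  exists2 S : {set I}, (forall A, A \in S -> D A) & G = facet_inter S.
Proof.
move=> fG G0; have [v [h [Gv _ Dh _ [rk [_ [_ H]]]]]] := face_vertex_structure fG G0.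
have [J GE] := H _ fG Gv; exists (h @: J) => //.
by move=> _ /imsetP[j _ ->].
Qed.

(** A nonempty face determines [S] as the set of all facets containing it, and its dimension
    determines [#|S|]. *)
Lemma card_faces_of_dim (k : nat) :
  #|` fset_set (faces_of_dim P k)|
    = #|[set S : {set I} | [forall A in S, D A] && `[< facet_inter S !=set0 >]
                           && (k + #|S| == n)%N]%SET|.
Proof.
set TS := [set S | _]%SET.
have inTS S : (S \in TS) -> (forall A, A \in S -> D A) /\ facet_inter S !=set0.
  by rewrite inE => /andP[/andP[/forall_inP SD /asboolP S0] _].
rewrite -(@card_fset_set_image _ _ TS facet_inter); last first.
  have le S S' : S \in TS -> S' \in TS -> facet_inter S `<=` facet_inter S' -> S' \subset S.
    move=> /inTS[SD S0] /inTS[SD' _] sub; apply/fintype.subsetP => A AS'.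
    apply: (facet_inter_dim SD S0).2; first exact: SD'.
    by move=> x /sub[_]; apply.
  by move=> S S' ST ST' E; apply/eqP; rewrite finset.eqEsubset !le // E.
congr #|` fset_set _|; apply/seteqP; split=> G.
  move=> [fG dG]; have G0 := has_dim_nonempty dG.
  have [S SD GE] := face_facet_inter fG G0; exists S => //=.
  rewrite inE; apply/andP; split.
    by apply/andP; split; [apply/forall_inP|apply/asboolP; rewrite -GE].
  rewrite GE in G0 dG; have [[l lE dl] _] := facet_inter_dim SD G0.
  by rewrite (has_dim_uniq dG dl) lE.
move=> [S /= ST <-]; have [SD S0] := inTS _ ST.
split; first exact: facet_inter_face.
have [[l lE dl] _] := facet_inter_dim SD S0.
by move: ST; rewrite inE => /andP[_ /eqP]; rewrite -lE => /addIn ->.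
Qed.

End SimplePolytope.

(** * The two f-vectors as counts of tubings *)

Lemma f_vector_ndp (R : realType) (n d : nat) (P : set 'rV[R]_d) (k : 'I_n.+1) :
  is_ndp_associahedron n P ->
  f_vector n P k = #|[set S | @ndp_tubing n S && (#|S| == n - k)%N]%SET|.
Proof.
move=> [simpleP [phi [phi_bij tubingP]]].
rewrite ffunE (card_faces_of_dim simpleP phi_bij).
congr #|pred_of_set _|; apply/setP => S; rewrite !inE.
have -> : (k + #|S| == n)%N = (#|S| == n - k)%N by have := ltn_ord k; lia.
congr andb; apply/andP/idP.
  move=> [/forall_inP St /asboolP S0]; apply/(tubingP _ St); split.
    move=> _ [A /= AS <-]; have [phiD _ _] := phi_bij; apply: phiD; exact: St.
  by rewrite bigcap_image.
move=> tS; have /andP[/forall_inP St _] := tS.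
split; first exact/forall_inP.
by apply/asboolP; have [_] := (tubingP _ St).1 tS; rewrite bigcap_image.
Qed.

Lemma f_vector_cyclohedron (R : realType) (n d : nat) (Q : set 'rV[R]_d) (k : 'I_n.+1) :
  is_cyclohedron n Q ->
  f_vector n Q k = #|[set S | @cycle_tubing n S && (#|S| == n - k)%N]%SET|.
Proof.
move=> [_ [psi [[psiD psi_inj psi_surj] _ psi_dim]]].
set TS := [set S | _]%SET; rewrite ffunE -(@card_fset_set_image _ _ TS psi); last first.
  by move=> S S'; rewrite !inE => /andP[tS _] /andP[tS' _]; apply: psi_inj; rewrite in_setE.
congr #|` fset_set _|; apply/seteqP; split=> F.
  move=> [fF dF]; have [S tS SF] : (psi @` [set S | cycle_tubing S]) F.
    by apply: psi_surj; split=> //; apply: has_dim_nonempty dF.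
  exists S => //=; rewrite inE tS /=; have [m mS dm] := psi_dim S tS.
  rewrite SF in dm; have km := has_dim_uniq dF dm.
  by apply/eqP/(@addnI m); rewrite mS -km subnKC // -ltnS.
move=> [S /=]; rewrite inE => /andP[tS /eqP Sk] <-.
have [fS _] := psiD S tS; split=> //.
have [m mS dm] := psi_dim S tS.
by rewrite (_ : nat_of_ord k = m) //; apply: (@addIn #|S|); rewrite mS Sk subnKC // -ltnS.
Qed.

Theorem proposition6p1p37 (R : realType) (n : nat) (hn : (0 < n)%N)
    (d1 d2 : nat) (P : set 'rV[R]_d1) (Q : set 'rV[R]_d2) :
  is_ndp_associahedron n P -> is_cyclohedron n Q ->
  f_vector n P = f_vector n Q.
Proof.
move=> hP hQ; apply/ffunP => k.
by rewrite (f_vector_ndp k hP) (f_vector_cyclohedron k hQ) card_tubings.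
Qed.
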